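(* Consider the deceptive Nash equilibrium seeking dynamics for the $N$-player oligopoly (described in the context), with $J^{\mathrm{ref}}\in\Omega$, i.e. the vector of reference costs $J^{\mathrm{ref}}$ is attainable. Then there exists $\varepsilon^*>0$ such that for all $\varepsilon\in(0,\varepsilon^* )$, there exists $a^*>0$ such that for $a_1,\dots,a_N\in(0,a^* )$ there exists $\omega^*>0$ such that for all $\omega>\omega^*$ the state $\zeta(t):=[u(t)\quad\delta(t)]^\top$ converges exponentially to an $\mathcal{O}\big(\frac1\omega+\max_i a_i\big)$-neighborhood of a point $\zeta^*:=[u^*\quad\delta^*]^\top$, provided $|\zeta(0)-\zeta^*|$ is sufficiently small.
   Context: **Oligopoly.** Let $N\ge 2$, $[N]=\{1,\dots,N\}$, $R_1,\dots,R_N>0$, and define $R_{\|},\overline{R}_i$ by $\frac{1}{R_{\|}}=\sum_{k=1}^N\frac1{R_k}$, $\frac1{\overline{R}_i}=\sum_{k\neq i}\frac1{R_k}$. Let $S_d$, $m_1,\dots,m_N$ be real constants. Player $i$ has cost $J_i(x)=-s_i(x)(x_i-m_i)$, $x\in\mathbb{R}^N$, with $s_i(x)=\frac{R_{\|}}{R_i}\big(S_d-\frac{x_i}{\overline{R}_i}+\sum_{j\neq i}\frac{x_j}{R_j}\big)$. Equivalently $J_i(x)=\frac12x^\top Q_ix+b_i^\top x+\frac{R_{\|}S_dm_i}{R_i}$, where $Q_i\in\mathbb{R}^{N\times N}$ has $[Q_i]_{ii}=\frac{2R_{\|}}{R_i\overline{R}_i}$, $[Q_i]_{jk}=-\frac{R_{\|}}{R_jR_k}$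 if $j\ne k$ and ($j=i$ or $k=i$), and $0$ otherwise; and $b_i\in\mathbb{R}^N$ has $[b_i]_i=-\frac{m_iR_{\|}}{R_i\overline{R}_i}-\frac{S_dR_{\|}}{R_i}$ and $[b_i]_k=\frac{m_iR_{\|}}{R_iR_k}$ for $k\ne i$. Let $\mathcal{Q}\in\mathbb{R}^{N\times N}$, $\mathcal{B}\in\mathbb{R}^N$ be given by $[\mathcal{Q}]_{i:}=[Q_i]_{i:}$ and $[\mathcal{B}]_i=[b_i]_i$, where $[E]_{i:}$ denotes row $i$ of $E$. **Deception structure.** $\mathcal{D}=\{z_1,\dots,z_n\}\subset[N]$ is the set of $n$ deceptive players; each $i\in\mathcal{D}$ deceives a nonempty set $\mathcal{D}_i\subset[N]\setminus\{i\}$. For $j\in[N]$, $\mathcal{K}_j=\{i\in\mathcal{D}:j\in\mathcal{D}_i\}$. For $\delta=[\delta_{z_1},\dots,\delta_{z_n}]^\top\in\mathbb{R}^n$ define $[\overline{\mathcal{Q}}(\delta)]_{i:}=[\mathcal{Q}]_{i:}+\sum_{k\in\mathcal{K}_i}\delta_k[Q_i]_{k:}$ and $[\overline{\mathcal{B}}(\delta)]_i=[\mathcal{B}]_i+\sum_{k\in\mathcal{K}_i}\delta_k\frac{m_iR_{\|}}{R_iR_k}$. **Dynamics.** Fixed data: gains $k_i>0$ ($i\in[N]$), $\varepsilon_i>0$ and reference costs $J_i^{\mathrm{ref}}\in\mathbb{R}$ ($i\in\mathcal{D}$), and pairwise distinct positive rationals $\overline{\omega}_1,\dots,\overline{\omega}_N$.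 Tunable parameters: $\varepsilon>0$, amplitudes $a_1,\dots,a_N>0$, and $\omega>0$; the frequencies are $\omega_i=\omega\overline{\omega}_i$. The state is $\zeta=(u,\delta)$ with $u=[u_1,\dots,u_N]^\top$, $\delta=[\delta_{z_1},\dots,\delta_{z_n}]^\top$. The actions are $x_i(t)=u_i(t)+a_i\sin(\omega_it)+\delta_i(t)\sum_{j\in\mathcal{D}_i}a_j\sin(\omega_jt)$ if $i\in\mathcal{D}$, and $x_i(t)=u_i(t)+a_i\sin(\omega_it)$ if $i\notin\mathcal{D}$; and the dynamics are $$\dot u_i=-\frac{2k_i}{a_i}J_i(x(t))\sin(\omega_it)\ \ (i\in[N]),\qquad \dot\delta_i=\varepsilon\,\varepsilon_i\big(J_i(x(t))-J_i^{\mathrm{ref}}\big)\ \ (i\in\mathcal{D}).$$ **Attainability.** Let $K=\mathrm{diag}(k_1,\dots,k_N)$ and $\Delta=\{\delta\in\mathbb{R}^n:-K\overline{\mathcal{Q}}(\delta)\text{ is Hurwitz}\}$. The vector $J^{\mathrm{ref}}=[J^{\mathrm{ref}}_{z_1},\dots,J^{\mathrm{ref}}_{z_n}]^\top$ is attainable if there exists $\delta^*\in\Delta$ such that: (1) $J_{z_k}(-\overline{\mathcal{Q}}(\delta^* )^{-1}\overline{\mathcal{B}}(\delta^* ))=J^{\mathrm{ref}}_{z_k}$ for all $k\in\{1,\dots,n\}$; and (2) the matrix $\Lambda(\delta^* )\in\mathbb{R}^{n\times n}$ with entries $[\Lambda(\delta^* )]_{jk}=\nabla_j\xi_k(\delta^*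 )$ (partial derivative with respect to the $j$-th coordinate) is Hurwitz, where $\xi_k(\delta):=\varepsilon_{z_k}J_{z_k}(-\overline{\mathcal{Q}}(\delta)^{-1}\overline{\mathcal{B}}(\delta))$. $\Omega\subset\mathbb{R}^n$ is the set of all attainable vectors. $|\cdot|$ is the Euclidean norm. *)

(* Defs.v *)
From HB Require Import structures.
From mathcomp Require Import all_boot all_order all_algebra.
From mathcomp Require Import complex.
From mathcomp Require Import all_classical all_reals all_analysis.

Set Implicit Arguments.
Unset Strict Implicit.
Unset Printing Implicit Defensive.

Import Order.TTheory GRing.Theory Num.Theory.
Import numFieldNormedType.Exports.

Local Open Scope classical_set_scope.
Local Open Scope ring_scope.

(* The library norm on matrices is the max norm, hence this definition. *)
Definition enorm (R : realType) (p : nat) (v : 'cV[R]_p) : R :=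
  Num.sqrt (\sum_i v i 0 ^+ 2).

Definition hurwitz (R : realType) (p : nat) (A : 'M[R]_p) : Prop :=
  forall s : R[i], eigenvalue (map_mx (real_complex R) A) s ->
    complex.Re s < 0.

Section Oligopoly.
Variables (R : realType) (N : nat).
Variables (r : 'I_N -> R) (Sd : R) (m : 'I_N -> R).

Definition Rpar : R := (\sum_k (r k)^-1)^-1.

Definition Rbar (i : 'I_N) : R := (\sum_(k | k != i) (r k)^-1)^-1.

Definition sales (i : 'I_N) (x : 'cV[R]_N) : R :=
  Rpar / r i * (Sd - x i 0 / Rbar i + \sum_(j | j != i) x j 0 / r j).

Definition J (i : 'I_N) (x : 'cV[R]_N) : R :=
  - sales i x * (x i 0 - m i).

Definition Q (i : 'I_N) : 'M[R]_N := \matrix_(j, k)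
  if j == k then (if j == i then 2 * Rpar / (r i * Rbar i) else 0)
  else if (j == i) || (k == i) then - (Rpar / (r j * r k)) else 0.

Definition b (i : 'I_N) : 'cV[R]_N := \col_k
  if k == i then - (m i * Rpar / (r i * Rbar i)) - Sd * Rpar / r i
  else m i * Rpar / (r i * r k).

Definition calQ : 'M[R]_N := \matrix_(i < N) row i (Q i).

Definition calB : 'cV[R]_N := \col_i b i i 0.

(* The deceptive players are z 0, ..., z (n - 1), with z injective; player z k
   deceives the players in Dec k. All data attached to deceptive players are
   indexed by k : 'I_n, so that the set K_i of the deceivers of player i is
   represented by the indices k such that i \in Dec k. *)
Variables (n : nat) (z : 'I_n -> 'I_N) (Dec : 'I_n -> {set 'I_N}).

Definition Qbar (delta : 'cV[R]_n) : 'M[R]_N := \matrix_(i < N)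
  (row i calQ + \sum_(k | i \in Dec k) delta k 0 *: row (z k) (Q i)).

Definition Bbar (delta : 'cV[R]_n) : 'cV[R]_N := \col_i
  (calB i 0 +
   \sum_(k | i \in Dec k) delta k 0 * (m i * Rpar / (r i * r (z k)))).

Definition ueq (delta : 'cV[R]_n) : 'cV[R]_N :=
  - (invmx (Qbar delta) *m Bbar delta).

Variables (gain : 'I_N -> R) (epsd : 'I_n -> R).

Definition Delta : set 'cV[R]_n :=
  [set delta | hurwitz (- (diag_mx (\row_i gain i) *m Qbar delta))].

Definition xi (k : 'I_n) (delta : 'cV[R]_n) : R :=
  epsd k * J (z k) (ueq delta).

Definition Lambda (delta : 'cV[R]_n) : 'M[R]_n :=
  \matrix_(j, k) 'D_(delta_mx j 0) (xi k) delta.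

Definition attains (delta Jref : 'cV[R]_n) : Prop :=
  [/\ delta \in Delta,
      forall k, J (z k) (ueq delta) = Jref k 0
    & hurwitz (Lambda delta)].

Definition Omega : set 'cV[R]_n :=
  [set Jref | exists delta, attains delta Jref].

Variables (Jref : 'cV[R]_n) (omb : 'I_N -> rat).
Variables (eps : R) (a : 'I_N -> R) (om : R).

Definition probe (i : 'I_N) (t : R) : R := sin (om * ratr (omb i) * t).

(* As z is injective, the outer sum has exactly one term when i is deceptive
   and none otherwise. *)
Definition action (t : R) (u : 'cV[R]_N) (delta : 'cV[R]_n) : 'cV[R]_N :=
  \col_i (u i 0 + a i * probe i t +
    \sum_(k | z k == i) delta k 0 * \sum_(j in Dec k) a j * probe j t).

Definition dyn (t : R) (zeta : 'cV[R]_(N + n)) : 'cV[R]_(N + n) :=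
  let x := action t (usubmx zeta) (dsubmx zeta) in
  col_mx (\col_i (- (2 * gain i / a i) * J i x * probe i t))
         (\col_k (eps * epsd k * (J (z k) x - Jref k 0))).

(* Solution on [0, +oo[; the values of zeta at negative times are irrelevant. *)
Definition solution (zeta : R -> 'cV[R]_(N + n)) : Prop :=
  {within `[0, +oo[%classic, continuous zeta} /\
  forall t : R, 0 < t -> is_derive t 1 zeta (dyn t (zeta t)).

End Oligopoly.

(* Main.v *)
Require Import Defs.
From mathcomp Require Import all_boot all_order all_algebra.
From mathcomp Require Import complex.
From mathcomp Require Import all_classical all_reals all_analysis.
From mathcomp Require Import ring lra.

Set Implicit Arguments.
Unset Strict Implicit.
Unset Printing Implicit Defensive.

Import Order.TTheory GRing.Theory Num.Theory.
Import numFieldNormedType.Exports.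

Local Open Scope classical_set_scope.
Local Open Scope ring_scope.

(* The probes enter the cost of each player through products of at most three
   sines. Products of one or three sines are odd, hence have zero mean, and a
   product of two has mean 1/2 or 0; so averaging gives exactly
     u' = - K (Qbar(delta) u + Bbar(delta)),
     delta_k' = eps * epsd_k * (J_(z k)(u) - Jref_k + O(max_i a_i ^ 2)).
   At (ueq(delta), delta) its linearization is [[A, B], [eps H, 0]], where
   A = - K Qbar(delta) and H (- A^-1 B) = Lambda(delta)^T are Hurwitz. Quadratic
   Lyapunov functions of these two matrices, obtained from Schur triangular
   forms, add up to one for the whole system when eps is small. Along a
   solution, a near-identity change of variables of size O(1/om) turns the
   oscillating vector field into the averaged one, and a Gronwall estimate
   together with a continuity argument confines the solution to a ball and
   yields the exponential bound. Solutions exist because the vector field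
   clipped to a box is bounded and Lipschitz, and the same estimate shows that
   the clipping is never active. *)

(** * Quadratic Lyapunov functions of Hurwitz matrices *)

(** The obstacle is the factor [1 / a i] in the action equations. The amplitudes are independent of
    each other, so a mean term of size [a l * a l' / a i] could not be bounded by [max_i a i]. Such
    terms come with products of three sines, and oddness removes them from the mean even at resonant
    frequencies. Only the deception equations keep a bias, quadratic in the amplitudes. The order of
    the quantifiers dictates the rest. The Jacobian and the quadratic remainder at the equilibrium
    involve [eps] but not [a], so the radius, the rate and the constants are fixed before [a]. The
    averaging constants depend on [a] but must be uniform in the frequency and in the trajectory,
    which come last. The frequency is then taken so large that the averaging error is itself at most
    [max_i a i]. *)

Section EuclideanNorm.
Variable R : realType.

Lemma term_le_sum (I : finType) (F : I -> R) i :
  (forall i, 0 <= F i) -> F i <= \sum_i F i.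
Proof. by move=> F0; rewrite (bigD1 i)//= lerDl sumr_ge0. Qed.

Definition dot p (u v : 'cV[R]_p) : R := \sum_i u i 0 * v i 0.

Lemma dotC p (u v : 'cV[R]_p) : dot u v = dot v u.
Proof. by apply: eq_bigr => i _; rewrite mulrC. Qed.

Lemma dotDr p (u v w : 'cV[R]_p) : dot u (v + w) = dot u v + dot u w.
Proof. by rewrite /dot -big_split; apply: eq_bigr => i _; rewrite mxE mulrDr. Qed.

Lemma dotZr p (k : R) (u v : 'cV[R]_p) : dot u (k *: v) = k * dot u v.
Proof. by rewrite /dot mulr_sumr; apply: eq_bigr => i _; rewrite mxE mulrCA. Qed.

Lemma dotDl p (u v w : 'cV[R]_p) : dot (v + w) u = dot v u + dot w u.
Proof. by rewrite dotC dotDr ![dot u _]dotC. Qed.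

Lemma dotZl p (k : R) (u v : 'cV[R]_p) : dot (k *: v) u = k * dot v u.
Proof. by rewrite dotC dotZr dotC. Qed.

Lemma dot_ge0 p (u : 'cV[R]_p) : 0 <= dot u u.
Proof. by apply: sumr_ge0 => i _; rewrite -expr2 sqr_ge0. Qed.

Lemma sqr_enorm p (u : 'cV[R]_p) : enorm u ^+ 2 = dot u u.
Proof.
rewrite sqr_sqrtr; first by apply: eq_bigr => i _; rewrite expr2.
by apply: sumr_ge0 => i _; rewrite sqr_ge0.
Qed.

Lemma enorm_ge0 p (u : 'cV[R]_p) : 0 <= enorm u.
Proof. exact: sqrtr_ge0. Qed.

Lemma enorm0 p : enorm (0 : 'cV[R]_p) = 0.
Proof. by rewrite /enorm big1 ?sqrtr0// => i _; rewrite mxE expr0n. Qed.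

Lemma enormN p (u : 'cV[R]_p) : enorm (- u) = enorm u.
Proof. by congr Num.sqrt; apply: eq_bigr => i _; rewrite mxE sqrrN. Qed.

(** Cauchy-Schwarz, read off the square of [enorm v *: u - enorm u *: v]. Zero norms are treated
    apart because [enorm u * enorm v] is cancelled at the end. *)
Lemma dot_le p (u v : 'cV[R]_p) : dot u v <= enorm u * enorm v.
Proof.
have [u0|u0] := eqVneq (enorm u) 0.
  rewrite u0 mul0r /dot big1// => i _.
  have /eqP : \sum_i u i 0 * u i 0 = 0 by rewrite -[LHS]sqr_enorm u0 expr0n.
  rewrite psumr_eq0; last by move=> j _; rewrite -expr2 sqr_ge0.
  by move=> /allP/(_ i (mem_index_enum _)); rewrite -expr2 sqrf_eq0 => /eqP->; rewrite mul0r.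
have [v0|v0] := eqVneq (enorm v) 0.
  rewrite v0 mulr0 /dot big1// => i _.
  have /eqP : \sum_i v i 0 * v i 0 = 0 by rewrite -[LHS]sqr_enorm v0 expr0n.
  rewrite psumr_eq0; last by move=> j _; rewrite -expr2 sqr_ge0.
  by move=> /allP/(_ i (mem_index_enum _)); rewrite -expr2 sqrf_eq0 => /eqP->; rewrite mulr0.
have up : 0 < enorm u by rewrite lt_def u0 enorm_ge0.
have vp : 0 < enorm v by rewrite lt_def v0 enorm_ge0.
have := dot_ge0 (enorm v *: u + (- enorm u) *: v).
rewrite !(dotDl, dotDr, dotZl, dotZr) -!sqr_enorm (dotC v u).
move: up vp; set a := enorm u; set b := enorm v; set d := dot u v => up vp.
move=> h; have {h} : 0 <= 2 * (a * b) * (a * b - d).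
  by apply: (le_trans h); rewrite le_eqVlt; apply/orP; left; apply/eqP; ring.
by rewrite pmulr_rge0 ?mulr_gt0// subr_ge0.
Qed.

Lemma enormD p (u v : 'cV[R]_p) : enorm (u + v) <= enorm u + enorm v.
Proof.
rewrite -(@ler_pXn2r _ 2) ?nnegrE ?addr_ge0 ?enorm_ge0//.
rewrite sqrrD !sqr_enorm dotDl !dotDr (dotC v u).
by have := dot_le u v; rewrite -mulr_natr; lra.
Qed.

Lemma coord_le_enorm p (u : 'cV[R]_p) i : `|u i 0| <= enorm u.
Proof.
rewrite -(@ler_pXn2r _ 2) ?nnegrE ?enorm_ge0// sqr_enorm real_normK ?num_real//.
rewrite /dot (bigD1 i)//= expr2 lerDl.
by apply: sumr_ge0 => j _; rewrite -expr2 sqr_ge0.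
Qed.

Lemma enormZ p (k : R) (u : 'cV[R]_p) : enorm (k *: u) = `|k| * enorm u.
Proof.
apply/eqP; rewrite -(@eqrXn2 _ 2) ?mulr_ge0 ?enorm_ge0//.
by rewrite exprMn !sqr_enorm dotZl dotZr mulrA real_normK ?num_real.
Qed.

Lemma enorm_eq0 p (u : 'cV[R]_p) : enorm u = 0 -> u = 0.
Proof.
move=> u0; apply/matrixP => i j; rewrite (ord1 j) mxE; apply/eqP.
by rewrite -normr_le0 -u0 coord_le_enorm.
Qed.

Lemma enorm_le_sum p (u : 'cV[R]_p) : enorm u <= \sum_i `|u i 0|.
Proof.
have s0 : 0 <= \sum_i `|u i 0| by apply: sumr_ge0.
rewrite -(@ler_pXn2r _ 2) ?nnegrE ?enorm_ge0// sqr_enorm.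
rewrite expr2 mulr_suml; apply: ler_sum => i _.
apply: (@le_trans _ _ (`|u i 0| * `|u i 0|)); first by rewrite -normrM ler_norm.
by apply: ler_wpM2l => //; rewrite (bigD1 i)//= lerDl; apply: sumr_ge0.
Qed.

(** The added [1] makes the constant positive even for [A = 0], so that later choices may divide by
    it. *)
Lemma enorm_mulmx p q (A : 'M[R]_(q, p)) :
  exists2 c, 0 < c & forall v : 'cV[R]_p, enorm (A *m v) <= c * enorm v.
Proof.
exists (1 + \sum_i \sum_j `|A i j|) => [|v].
  by rewrite ltr_wpDr// sumr_ge0// => i _; rewrite sumr_ge0.
rewrite (le_trans (enorm_le_sum _))// mulrDl mul1r ler_wpDl ?enorm_ge0//.
rewrite mulr_suml ler_sum// => i _; rewrite mxE mulr_suml.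
rewrite (le_trans (ler_norm_sum _ _ _))// ler_sum// => j _.
by rewrite normrM ler_wpM2l// coord_le_enorm.
Qed.

(* [V v = |G v|^2] is a quadratic Lyapunov function of [v' = A v]; the left
   inverse [G'] expresses its definiteness. *)
Definition lyapunov p (A : 'M[R]_p) : Prop :=
  exists q (G : 'M[R]_(q, p)) (G' : 'M[R]_(p, q)) c,
    [/\ 0 < c, G' *m G = 1%:M &
        forall v : 'cV[R]_p,
          dot (G *m v) (G *m (A *m v)) <= - c * dot (G *m v) (G *m v)].

End EuclideanNorm.

(** * Hurwitz matrices admit quadratic Lyapunov functions *)

Section HurwitzLyapunov.
Variable R : realType.
Local Notation Re := (@complex.Re R).
Local Notation Im := (@complex.Im R).

Lemma hurwitz_trmx p (A : 'M[R]_p) : hurwitz A -> hurwitz A^T.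
Proof.
move=> hA s; rewrite eigenvalue_root_char => sA; apply: hA.
rewrite eigenvalue_root_char; suff <- : char_poly (map_mx (real_complex R) A^T) =
  char_poly (map_mx (real_complex R) A) by [].
rewrite /char_poly -det_tr; congr (\det _).
by apply/matrixP => i j; rewrite !mxE eq_sym.
Qed.

Lemma hurwitz_unit p (A : 'M[R]_p) : hurwitz A -> A \in unitmx.
Proof.
move=> hA; rewrite -row_free_unit -kermx_eq0; apply/negPn/negP => kA.
have [v vA v0] : exists2 v : 'rV_p, v *m A = 0 & v != 0.
  have /rowV0Pn[v /sub_kermxP vA v0] := kA; by exists v.
suff /hA : eigenvalue (map_mx (real_complex R) A) 0 by rewrite ltxx.
apply/eigenvalueP; exists (map_mx (real_complex R) v).
  by rewrite -map_mxM vA map_mx0 scale0r.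
by rewrite map_mx_eq0.
Qed.

Lemma ReM (x y : R[i]) : Re (x * y) = Re x * Re y - Im x * Im y.
Proof. by case: x => ? ?; case: y. Qed.
Lemma ImM (x y : R[i]) : Im (x * y) = Re x * Im y + Im x * Re y.
Proof. by case: x => ? ?; case: y. Qed.

(** Triangularization in general requires [R[i]], while [lyapunov] asks for a real matrix: the
    complex change of coordinates is replaced by its real and imaginary parts, stacked. *)
Definition Remx p q (M : 'M[R[i]]_(p, q)) : 'M[R]_(p, q) := map_mx Re M.
Definition Immx p q (M : 'M[R[i]]_(p, q)) : 'M[R]_(p, q) := map_mx Im M.

Lemma RemxM p q r (A : 'M[R[i]]_(p, q)) (B : 'M[R[i]]_(q, r)) :
  Remx (A *m B) = Remx A *m Remx B - Immx A *m Immx B.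
Proof.
apply/matrixP => i j; rewrite !mxE raddf_sum/= -sumrB.
by apply: eq_bigr => k _; rewrite ReM !mxE.
Qed.

Lemma ImmxM p q r (A : 'M[R[i]]_(p, q)) (B : 'M[R[i]]_(q, r)) :
  Immx (A *m B) = Remx A *m Immx B + Immx A *m Remx B.
Proof.
apply/matrixP => i j; rewrite !mxE raddf_sum/= -big_split.
by apply: eq_bigr => k _; rewrite ImM !mxE.
Qed.

Lemma Remx_real p q (A : 'M[R]_(p, q)) : Remx (map_mx (real_complex R) A) = A.
Proof. by apply/matrixP => i j; rewrite !mxE. Qed.
Lemma Immx_real p q (A : 'M[R]_(p, q)) : Immx (map_mx (real_complex R) A) = 0.
Proof. by apply/matrixP => i j; rewrite !mxE. Qed.


Lemma pos_lower_bound (I : finType) (f : I -> R) : (forall i, 0 < f i) ->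
  exists2 c, 0 < c & forall i, c <= f i.
Proof.
(* The default value [1] keeps the minimum positive over an empty [I]. *)
move=> f0; exists (\big[Num.min/1]_i f i); first by apply: lt_bigmin.
by move=> i; apply: bigmin_le_cond.
Qed.

Lemma dot_col_mx p q (x x' : 'cV[R]_p) (y y' : 'cV[R]_q) :
  dot (col_mx x y) (col_mx x' y') = dot x x' + dot y y'.
Proof.
rewrite /dot big_split_ord/=.
by congr (_ + _); apply: eq_bigr => i _; rewrite ?(col_mxEu, col_mxEd).
Qed.

Lemma norm_dot2_le (x y x' y' : R) :
  `|x * x' + y * y'| <= (x ^+ 2 + y ^+ 2 + (x' ^+ 2 + y' ^+ 2)) / 2.
Proof.
rewrite ler_norml; apply/andP; split; rewrite -subr_ge0.
  have -> : (x * x' + y * y') - - ((x ^+ 2 + y ^+ 2 + (x' ^+ 2 + y' ^+ 2)) / 2)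
    = ((x + x') ^+ 2 + (y + y') ^+ 2) / 2 by field.
  by rewrite divr_ge0// addr_ge0// sqr_ge0.
have -> : (x ^+ 2 + y ^+ 2 + (x' ^+ 2 + y' ^+ 2)) / 2 - (x * x' + y * y')
    = ((x - x') ^+ 2 + (y - y') ^+ 2) / 2 by field.
by rewrite divr_ge0// addr_ge0// sqr_ge0.
Qed.

(* [x + i y] solves the complex system with matrix [a + i b]. *)
Lemma diag_dominant p (a b : 'M[R]_p) (c eta : R) (x y : 'cV[R]_p) :
  0 <= eta -> (forall j, a j j <= - c) ->
  (forall j k, j != k -> `|a j k| + `|b j k| <= eta) ->
  dot x (a *m x - b *m y) + dot y (a *m y + b *m x) <=
    (- c + eta * p%:R) * (dot x x + dot y y).
Proof.
move=> eta0 ac abeta.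
pose e j := x j 0 ^+ 2 + y j 0 ^+ 2.
have e0 j : 0 <= e j by rewrite addr_ge0 ?sqr_ge0.
have eE : dot x x + dot y y = \sum_j e j by rewrite /dot -big_split.
pose t j k := a j k * (x j 0 * x k 0 + y j 0 * y k 0)
   + b j k * (y j 0 * x k 0 - x j 0 * y k 0).
have -> : dot x (a *m x - b *m y) + dot y (a *m y + b *m x) =
    \sum_j \sum_k t j k.
  rewrite /dot -big_split; apply: eq_bigr => j _ /=.
  rewrite !mxE !mulrDr mulrN !mulr_sumr -sumrN -!big_split/=.
  by apply: eq_bigr => k _; rewrite /t; ring.
(* Off the diagonal, products are shared equally between [e j] and [e k]. Charging the same [eta] on
   the diagonal makes the double sum exactly [eta * p] times the total. *)
have tle j k : t j k <= (if j == k then - c * e j else 0) + eta * (e j + e k) / 2.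
  have [<-|jk] := eqVneq j k.
    have -> : t j j = a j j * e j by rewrite /t /e; ring.
    have := ler_wpM2r (e0 j) (ac j); have : 0 <= eta * e j by rewrite mulr_ge0.
    by lra.
  rewrite add0r; apply: (@le_trans _ _ ((`|a j k| + `|b j k|) * ((e j + e k) / 2))).
    have P (u v s : R) : `|u| <= s -> v * u <= `|v| * s.
      by move=> us; rewrite (le_trans (ler_norm _))// normrM ler_wpM2l.
    have -> : (e j + e k) / 2 =
      (x j 0 ^+ 2 + y j 0 ^+ 2 + (x k 0 ^+ 2 + y k 0 ^+ 2)) / 2 by [].
    rewrite mulrDl lerD// P ?norm_dot2_le//.
    rewrite (addrC (_ ^+ 2) (y j 0 ^+ 2)) -mulrN.
    by rewrite -(sqrrN (y k 0)) (le_trans (norm_dot2_le _ _ _ _)).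
  rewrite -mulrA ler_wpM2r ?abeta//.
  by apply: divr_ge0 => //; apply: addr_ge0; exact: e0.
apply: le_trans (_ : \sum_j \sum_k ((if j == k then - c * e j else 0) +
  eta * (e j + e k) / 2) <= _).
  by apply: ler_sum => j _; apply: ler_sum => k _; exact: tle.
rewrite le_eqVlt; apply/orP; left; apply/eqP.
transitivity (\sum_j (- c * e j + (eta / 2 * p%:R) * e j + eta / 2 * \sum_k e k)).
  apply: eq_bigr => j _; rewrite big_split/= -big_mkcond/=.
  rewrite (big_pred1 j) => [|k]; last by rewrite /= eq_sym.
  rewrite -addrA; congr (_ + _).
  transitivity (\sum_k (eta / 2 * e j + eta / 2 * e k)).
    by apply: eq_bigr => k _; field.
  by rewrite big_split/= sumr_const card_ord -mulr_sumr -mulr_natr; ring.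
rewrite eE; set S := \sum_k e k.
rewrite 2!big_split/= sumr_const card_ord -!mulr_sumr -/S -mulr_natr; by field.
Qed.

(** Conjugating a triangular form by the powers [eta ^+ j] keeps its diagonal and multiplies the
    entry [(j, k)] by [eta ^+ (j - k)]. For small [eta] the diagonal, whose real parts are at most
    [- c], dominates, and half of [c] survives. *)
Theorem hurwitz_lyapunov p (A : 'M[R]_p) : hurwitz A -> lyapunov A.
Proof.
(* [Schur] needs a positive dimension. *)
case: (posnP p) => [p0|p_gt0] hA.
  exists 0%N, 0, 0, 1; split => // [|v]; last by rewrite /dot !big_ord0 mulr0.
  by apply/matrixP => -[i ip]; exfalso; move: ip; rewrite p0.
pose AC := map_mx (real_complex R) A.
have [P Pu PT] := Schur AC p_gt0.
have {}Pu : P \in unitmx by exact: unitarymx_unit.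
pose T := P *m AC *m invmx P.
have {}PT : is_trig_mx T by move: PT; rewrite /similar_to /= conjumx.
have TP : T *m P = P *m AC by rewrite mulmxKV.
have reT j : 0 < - Re (T j j).
  rewrite oppr_gt0; apply: hA.
  have /eigenvalueP[v vT v0] : eigenvalue T (T j j).
    rewrite eigenvalue_root_char char_poly_trig//; apply/eqP.
    by rewrite horner_prod (bigD1 j)//= hornerXsubC subrr mul0r.
  apply/eigenvalueP; exists (v *m P); last first.
    by apply: contraNneq v0 => vP; rewrite -(mulmxK Pu v) vP mul0mx.
  by rewrite -mulmxA -TP mulmxA vT scalemxAl.
have [c c0 cT] := pos_lower_bound reT.
clearbody T.
pose B := 1 + \sum_j \sum_k (`|Re (T j k)| + `|Im (T j k)|).
have B1 : 1 <= B by rewrite lerDl sumr_ge0// => j _; rewrite sumr_ge0// => k _; rewrite addr_ge0.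
have BT j k : `|Re (T j k)| + `|Im (T j k)| <= B.
  apply: (@le_trans _ _ (\sum_k (`|Re (T j k)| + `|Im (T j k)|))).
    by apply: (term_le_sum (F := fun k => `|Re (T j k)| + `|Im (T j k)|)) => l; rewrite addr_ge0.
  rewrite ler_wpDl//.
  by apply: (term_le_sum (F := fun j => \sum_k (`|Re (T j k)| + `|Im (T j k)|))) => l;
    rewrite sumr_ge0// => i _; rewrite addr_ge0.
have Bp : 0 <= 2 * B * p%:R by rewrite !mulr_ge0//; lra.
(* The summand [c] in the denominator gives [eta <= 1], hence [eta ^+ (j - k) <= eta] below the
   diagonal; the other one gives [eta * B * p <= c / 2]. *)
pose eta := c / (2 * B * p%:R + c).
have den0 : 0 < 2 * B * p%:R + c by rewrite ltr_wpDl.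
have eta0 : 0 < eta by rewrite divr_gt0.
have eta1 : eta <= 1 by rewrite ler_pdivrMr// mul1r lerDr.
have etaB : eta * B * p%:R <= c / 2.
  suff : eta * (2 * B * p%:R) <= c by lra.
  by rewrite /eta mulrAC ler_pdivrMr// ler_pM2l// lerDl ltW.
pose D : 'M[R[i]]_p := diag_mx (\row_j (eta ^+ j)%:C)%C.
pose D' : 'M[R[i]]_p := diag_mx (\row_j ((eta^-1) ^+ j)%:C)%C.
have D'D : D' *m D = 1%:M.
  apply/matrixP => i j; rewrite mul_diag_mx !mxE.
  have [->|ij] := eqVneq i j; last by rewrite mulr0n mulr0.
  by rewrite mulr1n -rmorphM/= -exprMn mulVf ?expr1n// gt_eqF.
pose L := D *m P; pose Li := invmx P *m D'.
have LiL : Li *m L = 1%:M by rewrite /Li /L mulmxA -(mulmxA _ D') D'D mulmx1 mulVmx.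
pose T' := D *m T *m D'.
have T'E j k : T' j k = (eta ^+ j * eta^-1 ^+ k)%:C%C * T j k.
  rewrite /T' mul_mx_diag mul_diag_mx !mxE rmorphM/=; ring.
have LA : L *m AC = T' *m L.
  by rewrite /L /T' !mulmxA -(mulmxA _ D') D'D mulmx1 -(mulmxA D T P) TP mulmxA.
clearbody T'.
have RA : Remx L *m A = Remx T' *m Remx L - Immx T' *m Immx L.
  by rewrite -RemxM -LA RemxM Remx_real Immx_real mulmx0 subr0.
have IA : Immx L *m A = Remx T' *m Immx L + Immx T' *m Remx L.
  by rewrite -ImmxM -LA ImmxM Remx_real Immx_real mulmx0 add0r.
exists (p + p)%N, (col_mx (Remx L) (Immx L)), (row_mx (Remx Li) (- Immx Li)), (c / 2).
split; first by rewrite divr_gt0.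
  rewrite mul_row_col mulNmx -RemxM LiL.
  by apply/matrixP => i j; rewrite !mxE; case: (i == j).
move=> v; rewrite !mul_col_mx !mulmxA RA IA mulmxBl mulmxDl -!mulmxA !dot_col_mx.
apply: (le_trans (diag_dominant (c := c) (eta := eta * B) _ _ _ _ _)).
- by rewrite mulr_ge0//; lra.
- move=> j; rewrite mxE T'E -exprMn divff ?gt_eqF// expr1n mul1r.
  by rewrite lerNr; exact: cT.
- move=> j k jk; rewrite !mxE T'E ReM ImM/= !mul0r subr0 addr0.
  have [ljk|lkj|/val_inj /eqP] := ltngtP j k; last by rewrite (negbTE jk).
    move/is_trig_mxP : PT => /(_ _ _ ljk) ->.
    by rewrite /= !mulr0 normr0 addr0 mulr_ge0//; lra.
  rewrite !normrM -mulrDr -normrM ler_pM// exprVn -expfB// ger0_norm.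
    rewrite -[leRHS]expr1 ler_wiXn2l// ?subn_gt0//; exact: ltW.
  by rewrite exprn_ge0// ltW.
- apply: ler_wpM2r; first by rewrite addr_ge0 ?dot_ge0.
  by move: etaB; lra.
Qed.

End HurwitzLyapunov.

(** * Singular perturbations *)

Section SingularPerturbation.
Variable R : realType.

(** Cauchy-Schwarz in Lyapunov coordinates: the left inverse factors [M] as [M *m N' *m N], so
    [enorm (N *m v)] can stand for the norm of [v]. *)
Lemma dot_mulmx_le p q r (M : 'M[R]_(p, q)) (N : 'M[R]_(r, q)) (N' : 'M[R]_(q, r)) :
  N' *m N = 1%:M ->
  exists2 k, 0 < k & forall (u : 'cV[R]_p) (v : 'cV[R]_q),
    `|dot u (M *m v)| <= k * (enorm u * enorm (N *m v)).
Proof.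
move=> N'N; have [k k0 kM] := enorm_mulmx (M *m N').
exists k => // u v; have -> : M *m v = M *m N' *m (N *m v).
  by rewrite -mulmxA (mulmxA N') N'N mul1mx.
rewrite mulrCA ler_norml; apply/andP; split.
  rewrite lerNl -mulN1r -dotZr scaleN1r (le_trans (dot_le _ _))// enormN.
  by rewrite ler_wpM2l ?enorm_ge0.
by rewrite (le_trans (dot_le _ _))// ler_wpM2l ?enorm_ge0.
Qed.

(* In the coordinates [v = w - L d], where [w = L d] is the slow manifold, the
   system is block triangular up to terms of order [eps]; the sum of the two
   Lyapunov functions then works. *)
Theorem singular_perturbation p q (A : 'M[R]_p) (B : 'M[R]_(p, q)) (H : 'M[R]_(q, p)) :
  A \in unitmx -> lyapunov A -> lyapunov (H *m (- (invmx A *m B))) ->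
  exists2 e, 0 < e & forall eps, 0 < eps < e ->
    lyapunov (block_mx A B (eps *: H) 0).
Proof.
move=> Au [q1 [G1 [G1' [c1 [c10 G1K V1]]]]].
set L := - (invmx A *m B) => -[q2 [G2 [G2' [c2 [c20 G2K V2]]]]].
have AL : A *m L = - B by rewrite /L mulmxN mulmxA mulmxV// mul1mx.
clearbody L.
(* As [w = v + L d], the motion of the slow manifold feeds [eps L H w] back into [v]: [k1] and [k2]
   bound its two parts, and [k3] bounds the effect of [v] on [d]. *)
have [k1 k10 K1] := dot_mulmx_le (G1 *m L *m H) G1K.
have [k2 k20 K2] := dot_mulmx_le (G1 *m L *m H *m L) G2K.
have [k3 k30 K3] := dot_mulmx_le (G2 *m H) G1K.
pose k := k2 + k3; pose K := k1 + k ^+ 2 / (2 * c2).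
have K0 : 0 < K by rewrite ltr_wpDr// divr_ge0 ?sqr_ge0// mulr_ge0 ?ltW.
(* Young's inequality below pays for the cross terms with half of [c2] and a multiple of [X ^+ 2];
   the total [eps * K] in front of [X ^+ 2] then stays below [c1 / 2]. *)
exists (c1 / (2 * K)) => [|eps /andP[eps0]]; first by rewrite divr_gt0// mulr_gt0.
rewrite ltr_pdivlMr ?mulr_gt0// => epsK.
exists (q1 + q2)%N, (block_mx G1 (- (G1 *m L)) 0 G2), (block_mx G1' (L *m G2') 0 G2').
exists (Num.min (c1 / 2) (eps * c2 / 2)); split.
- by rewrite lt_min !divr_gt0// mulr_gt0.
- rewrite mulmx_block !mulmx0 !mul0mx !addr0 !add0r G1K mulmxN mulmxA G1K mul1mx.
  by rewrite -mulmxA G2K mulmx1 addNr -scalar_mx_block.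
- move=> x; rewrite -(vsubmxK x); set w := usubmx x; set d := dsubmx x.
  pose v := w - L *m d.
  have wE : w = v + L *m d by rewrite subrK.
  rewrite !mul_block_col !mul0mx !addr0 !add0r !mulNmx -!mulmxA.
  rewrite -!mulmxBr -/v.
  have -> : A *m w + B *m d - L *m (eps *: H *m w) = A *m v - eps *: (L *m (H *m w)).
    by rewrite -scalemxAl -scalemxAr /v mulmxBr (mulmxA A L) AL mulNmx opprK.
  rewrite !dot_col_mx.
  have -> : G1 *m (A *m v - eps *: (L *m (H *m w))) =
      G1 *m (A *m v) + - eps *: (G1 *m L *m H *m v + G1 *m L *m H *m L *m d).
    by rewrite mulmxBr -scalemxAr scaleNr wE !mulmxDr !mulmxA.
  have -> : G2 *m (eps *: H *m w) = eps *: (G2 *m H *m v + G2 *m (H *m L *m d)).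
    by rewrite -scalemxAl -scalemxAr wE !mulmxDr !mulmxA.
  rewrite !(dotDr, dotZr).
  have := V1 v; have := V2 d.
  have := K1 (G1 *m v) v; have := K2 (G1 *m v) d; have := K3 (G2 *m d) v.
  rewrite -!sqr_enorm.
  set X := enorm (G1 *m v); set Y := enorm (G2 *m d).
  rewrite !ler_norml => /andP[_ h3] /andP[h2 _] /andP[h1 _] h4 h5.
  set D1 := dot _ _ in h5 *; set D2 := dot _ _ in h1 *; set D3 := dot _ _ in h2 *.
  set D4 := dot _ _ in h3 *; set D5 := dot _ _ in h4 *.
  apply: (@le_trans _ _ (- c1 * X ^+ 2 + eps * (k1 * X ^+ 2 + k * (X * Y) - c2 * Y ^+ 2))).
    have -> : D1 + - eps * (D2 + D3) + eps * (D4 + D5) =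
      D1 + eps * ((- D2) + (- D3) + D4 + D5) by ring.
    apply: lerD => //; rewrite ler_pM2l//.
    move: h1 h2 h3 h4; rewrite /k (mulrC Y X) !expr2; lra.
  have young : k * (X * Y) <= k ^+ 2 / (2 * c2) * X ^+ 2 + c2 / 2 * Y ^+ 2.
    rewrite -subr_ge0; have -> : k ^+ 2 / (2 * c2) * X ^+ 2 + c2 / 2 * Y ^+ 2 - k * (X * Y)
      = (k * X - c2 * Y) ^+ 2 / (2 * c2) by field; rewrite gt_eqF.
    by rewrite divr_ge0 ?sqr_ge0// mulr_ge0 ?ltW.
  set mu := Num.min _ _.
  have mu1 : mu <= c1 / 2 by rewrite ge_min lexx.
  have mu2 : mu <= eps * c2 / 2 by rewrite ge_min lexx orbT.
  have X0 : 0 <= X ^+ 2 by rewrite sqr_ge0.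
  have Y0 : 0 <= Y ^+ 2 by rewrite sqr_ge0.
  have := ler_wpM2r X0 mu1; have := ler_wpM2r Y0 mu2.
  have := ler_wpM2l (ltW eps0) young.
  have := ler_wpM2r X0 (ltW epsK); rewrite /K.
  lra.
Qed.

End SingularPerturbation.

(** * Practical exponential stability *)

Section PracticalStability.
Variable R : realType.
Implicit Types (s t T : R).

Lemma continuous_near_lt (f : R -> R) (a c : R) : {for a, continuous f} ->
  f a < c -> exists2 d, 0 < d & forall t, `|t - a| < d -> f t < c.
Proof.
move=> cf fac; have /nbhs_ballP[d d0 dP] : \forall t \near a, f t < c.
  by move/cvgr_lt : cf => /(_ _ fac).
by exists d => // t td; apply: dP; rewrite /ball/= distrC.
Qed.

(** At the infimum of the times where [f] reaches [c], continuity forces the value [c], while [step]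
    applies up to that time and forbids it. *)
Lemma bootstrap (f : R -> R) (c : R) : continuous f -> f 0 < c ->
  (forall T, 0 < T -> (forall t, 0 < t <= T -> f t <= c) -> f T < c) ->
  forall t, 0 <= t -> f t < c.
Proof.
move=> cf f0 step t1 t10; rewrite ltNge; apply/negP => ft1.
pose S : set R := [set s | 0 <= s /\ c <= f s].
have S0 : S !=set0 by exists t1.
have lbS : has_lbound S by exists 0 => s [].
have iS : has_inf S by [].
have inf_ge0 : 0 <= inf S by apply: lb_le_inf => // s [].
have before t : 0 <= t -> t < inf S -> f t < c.
  move=> t0 tS; rewrite ltNge; apply/negP => cft.
  by move: tS; rewrite ltNge => /negP; apply; apply: ge_inf.
have f_inf : c <= f (inf S).
  rewrite leNgt; apply/negP => /(continuous_near_lt (cf _))[d d0 dP].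
  have [s [s0 cs] sd] := inf_adherent d0 iS.
  have := dP s; rewrite ger0_norm ?subr_ge0 ?ge_inf//.
  by rewrite ltrBlDl => /(_ sd); rewrite ltNge cs.
have inf_gt0 : 0 < inf S.
  rewrite lt_def inf_ge0 andbT; apply: contraTneq f_inf => ->.
  by rewrite -ltNge.
have f_inf_le : f (inf S) <= c.
  rewrite leNgt; apply/negP => fS.
  have cNf : {for inf S, continuous (fun t => - f t)} by apply: continuousN; exact: cf.
  have [|d d0 dP] := continuous_near_lt (c := - c) cNf; first by rewrite ltrN2.
  pose s := Num.max 0 (inf S - d / 2).
  have s0 : 0 <= s by rewrite le_max lexx.
  have sS : s < inf S by rewrite gt_max inf_gt0/= ltrBlDr ltrDl divr_gt0.
  have := before s s0 sS; rewrite ltNge => /negP; apply.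
  apply: ltW; rewrite -ltrN2; apply: dP.
  rewrite distrC ger0_norm ?subr_ge0 ?ltW//.
  rewrite ltrBlDl -ltrBlDr (@lt_le_trans _ _ (inf S - d / 2))//.
    by rewrite ltrD2l ltrN2; lra.
  by rewrite le_max lexx orbT.
have := step _ inf_gt0; rewrite ltNge f_inf => /(_ _)/negP; apply=> //.
move=> t /andP[t0]; rewrite le_eqVlt => /predU1P[->//|tS].
by apply: ltW; apply: before => //; apply: ltW.
Qed.

Lemma is_derive_mul (f g : R -> R) t df dg :
  is_derive t 1 f df -> is_derive t 1 g dg ->
  is_derive t 1 (fun t => f t * g t) (df * g t + f t * dg).
Proof.
move=> hf hg; have D := is_deriveM hf hg; apply: (is_derive_eq D).
by rewrite /GRing.scale/= addrC; congr (_ + _); rewrite mulrC.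
Qed.

Lemma is_derive_add (f g : R -> R) t df dg :
  is_derive t 1 f df -> is_derive t 1 g dg ->
  is_derive t 1 (fun t => f t + g t) (df + dg).
Proof. by move=> hf hg; exact: is_deriveD. Qed.

Lemma is_derive_lin (g u : R) : is_derive u 1 (fun u => g * u) g.
Proof.
have := is_deriveZ g (is_derive_id u (1 : R)).
by rewrite /GRing.scale/= mulr1.
Qed.

Lemma is_derive_expR_lin (g u : R) :
  is_derive u 1 (fun u => expR (g * u)) (expR (g * u) * g).
Proof.
exact: (is_derive1_comp (f := expR) (is_derive_expR _) (is_derive_lin g u)).
Qed.

(** The function [expR (g * u) * (V u - b / g)] is nonincreasing. *)
Lemma gronwall_exp (V dV : R -> R) (g b s t : R) : 0 < g -> 0 <= b -> s <= t ->
  (forall u, s <= u <= t -> is_derive u 1 V (dV u)) ->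
  (forall u, s <= u <= t -> dV u <= - g * V u + b) ->
  V t <= expR (- g * (t - s)) * V s + b / g.
Proof.
move=> g0 b0 st dVE dVle.
pose W u := expR (g * u) * (V u - b / g).
have dW u : s <= u <= t -> is_derive u 1 W (expR (g * u) * (g * V u - b + dV u)).
  move=> /dVE dVu.
  have dE : is_derive u 1 (fun u => expR (g * u)) (expR (g * u) * g).
    exact: is_derive_expR_lin.
  apply: is_derive_eq; rewrite /GRing.scale/=.
  by field; rewrite gt_eqF.
have dW' u : u \in `]s, t[ -> is_derive u 1 W (expR (g * u) * (g * V u - b + dV u)).
  by rewrite in_itv/= => /andP[su ut]; apply: dW; rewrite !ltW.
have cW : {within `[s, t], continuous W}.
  by apply: derivable_within_continuous => u; rewrite in_itv/= => /dW [].
have [c] := MVT_segment st dW' cW.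
rewrite in_itv/= => /[dup] sct /andP[sc ct] WE.
have : W t <= W s.
  rewrite -subr_le0 WE mulr_le0_ge0 ?subr_ge0//.
  rewrite pmulr_rle0 ?expR_gt0//.
  by have := dVle _ sct; lra.
rewrite /W -(ler_pM2l (expR_gt0 (- (g * t)))) !mulrA -!expRD addNr expR0 mul1r.
have -> : - (g * t) + g * s = - g * (t - s) by ring.
rewrite lerBlDr => h; apply: (le_trans h); rewrite lerD2r ler_pM2l ?expR_gt0//.
by rewrite gerBl divr_ge0// ltW.
Qed.

Lemma is_derive_mulmx p q (G : 'M[R]_(q, p)) (y : R -> 'cV[R]_p) (dy : 'cV[R]_p) t :
  (forall i, is_derive t 1 (fun t => y t i 0) (dy i 0)) ->
  forall j, is_derive t 1 (fun t => (G *m y t) j 0) ((G *m dy) j 0).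
Proof.
move=> h j.
have -> : (fun t => (G *m y t) j 0) = \sum_i (fun t => G j i * y t i 0).
  by apply/funext => u; rewrite mxE fct_sumE.
by rewrite mxE; apply: is_derive_sum.
Qed.

Lemma is_derive_dot p (y : R -> 'cV[R]_p) (dy : 'cV[R]_p) t :
  (forall i, is_derive t 1 (fun t => y t i 0) (dy i 0)) ->
  is_derive t 1 (fun t => dot (y t) (y t)) (2 * dot (y t) dy).
Proof.
move=> h.
have -> : (fun t => dot (y t) (y t)) = \sum_i (fun t => y t i 0 * y t i 0).
  by apply/funext => u; rewrite fct_sumE.
rewrite /dot mulr_sumr; apply: is_derive_sum => i.
by apply: (is_derive_eq (is_derive_mul (h i) (h i))); ring.
Qed.

(** Gronwall is applied to the quadratic [V], as the norm need not be differentiable at [0], and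
    square roots are taken afterwards: [V] decays at rate [c / 2], hence the norm at rate
    [c / 4]. *)
Lemma lyapunov_estimate p (A : 'M[R]_p) : lyapunov A ->
  exists eta M lam C : R, [/\ 0 < eta, 1 <= M, 0 < lam & 0 < C] /\
  forall (y r : R -> 'cV[R]_p) (b s t : R), s <= t -> 0 <= b ->
   (forall u, s <= u <= t ->
      (forall i, is_derive u 1 (fun t => y t i 0) ((A *m y u + r u) i 0)) /\
      enorm (r u) <= eta * enorm (y u) + b) ->
   enorm (y t) <= M * expR (- lam * (t - s)) * enorm (y s) + C * b.
Proof.
move=> [q [G [G' [c [c0 G'G cG]]]]].
have [g g0 gG] := enorm_mulmx G.
have [g' g'0 gG'] := enorm_mulmx G'.
have g'P (v : 'cV[R]_p) : enorm v <= g' * enorm (G *m v).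
  by rewrite -{1}(mul1mx v) -G'G -mulmxA; exact: gG'.
(* With this [eta] the linear part of [r] consumes half of the decay [c]; Young's inequality
   consumes half of what is left to absorb [b]. *)
pose eta := c / (2 * (g * g')).
exists eta, (g' * g + 1), (c / 4), (2 * g' * g / c); split.
  split; rewrite ?divr_gt0 ?mulr_gt0//.
  by rewrite lerDr mulr_ge0 ?ltW.
move=> y r b s t st b0 h.
pose V u := dot (G *m y u) (G *m y u).
have V0 u : 0 <= V u by exact: dot_ge0.
have sV u : enorm (G *m y u) = Num.sqrt (V u).
  by rewrite /V -sqr_enorm sqrtr_sqr ger0_norm ?enorm_ge0.
have c20 : 0 < c / 2 by rewrite divr_gt0.
have cb0 : 0 <= 2 / c * (g * b) ^+ 2 by rewrite mulr_ge0 ?sqr_ge0// divr_ge0// ltW.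
have dVE u : s <= u <= t ->
    is_derive u 1 V (2 * dot (G *m y u) (G *m (A *m y u + r u))).
  move=> sut; by apply: is_derive_dot => i; apply: is_derive_mulmx; case: (h u sut).
have dVle u : s <= u <= t -> 2 * dot (G *m y u) (G *m (A *m y u + r u)) <=
    - (c / 2) * V u + 2 / c * (g * b) ^+ 2.
  move=> sut; have [_ ru] := h u sut.
  rewrite mulmxDr dotDr.
  have h1 := cG (y u).
  have h2 : dot (G *m y u) (G *m r u) <= c / 2 * V u + Num.sqrt (V u) * (g * b).
    rewrite (le_trans (dot_le _ _))// sV.
    have gr : enorm (G *m r u) <= c / 2 * Num.sqrt (V u) + g * b.
      apply: (le_trans (gG _)).
      apply: (@le_trans _ _ (g * (eta * (g' * Num.sqrt (V u)) + b))).
        by rewrite ler_pM2l// (le_trans ru)// lerD2r ler_pM2l ?divr_gt0 ?mulr_gt0// -sV.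
      rewrite le_eqVlt; apply/orP; left; apply/eqP; rewrite /eta.
      by field; rewrite !gt_eqF.
    apply: (le_trans (ler_wpM2l (sqrtr_ge0 _) gr)).
    by rewrite mulrDr mulrCA -expr2 sqr_sqrtr.
  set X := Num.sqrt (V u) in h2.
  have XV : X ^+ 2 = V u by rewrite sqr_sqrtr.
  have young : 2 * (X * (g * b)) <= c / 2 * V u + 2 / c * (g * b) ^+ 2.
    rewrite -XV -subr_ge0.
    have -> : c / 2 * X ^+ 2 + 2 / c * (g * b) ^+ 2 - 2 * (X * (g * b)) =
      (c * X - 2 * (g * b)) ^+ 2 / (2 * c) by field; rewrite gt_eqF.
    by rewrite divr_ge0 ?sqr_ge0// mulr_ge0 ?ltW.
  by move: h1; rewrite -/(V u); lra.
have := gronwall_exp c20 cb0 st dVE dVle.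
set B := 2 * g / c * b.
  have B0 : 0 <= B by rewrite !mulr_ge0 ?invr_ge0// ltW.
  have -> : 2 / c * (g * b) ^+ 2 / (c / 2) = B ^+ 2.
    by rewrite /B; field; rewrite gt_eqF.
  have -> : expR (- (c / 2) * (t - s)) = expR (- (c / 4) * (t - s)) ^+ 2.
    by rewrite expr2 -expRD; congr expR; field.
  set E := expR _; have E0 : 0 < E by exact: expR_gt0.
  move=> hV.
  have : Num.sqrt (V t) <= E * Num.sqrt (V s) + B.
    rewrite -(@ler_pXn2r _ 2) ?nnegrE ?sqrtr_ge0//; last first.
      by rewrite addr_ge0// mulr_ge0 ?sqrtr_ge0// ltW.
    rewrite sqr_sqrtr// (le_trans hV)// sqrrD [(E * _) ^+ 2]exprMn sqr_sqrtr//.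
    rewrite lerD2r lerDl; apply: mulrn_wge0; apply: mulr_ge0 B0.
    by rewrite mulr_ge0 ?sqrtr_ge0 ?(ltW E0).
  rewrite -!sV => hG; apply: (le_trans (g'P _)).
  apply: (le_trans (ler_wpM2l (ltW g'0) hG)).
  apply: (@le_trans _ _ (g' * (E * (g * enorm (y s)) + B))).
    by rewrite ler_pM2l// lerD2r ler_pM2l.
  have : 0 <= E * enorm (y s) by rewrite mulr_ge0 ?enorm_ge0 ?ltW.
  have -> : 2 * g' * g / c * b = g' * B by rewrite /B; ring.
  by lra.
Qed.

Lemma continuous_big_sum (I : finType) (P : pred I) (f : I -> R -> R) :
  (forall i, P i -> continuous (f i)) -> continuous (fun t => \sum_(i | P i) f i t).
Proof.
move=> cf; elim: (index_enum I) => [|i r IH].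
  by under eq_fun do rewrite big_nil; move=> t; exact: cst_continuous.
under eq_fun do rewrite big_cons.
case Pi : (P i) => //.
by move=> t; apply: continuousD; [exact: cf|exact: IH].
Qed.

Lemma continuous_enorm p (x : R -> 'cV[R]_p) :
  (forall i, continuous (fun t => x t i 0)) -> continuous (fun t => enorm (x t)).
Proof.
move=> cx t.
apply: (@continuous_comp _ _ _ (fun t => \sum_i x t i 0 ^+ 2) Num.sqrt);
  last exact: sqrt_continuous.
move: t; apply: continuous_big_sum => i _ t.
apply: (@continuous_comp _ _ _ (fun t => x t i 0) (fun u => u ^+ 2)).
  exact: cx.
exact: exprn_continuous.
Qed.

(* [w] is the near-identity change of variables of averaging theory; [b]
   bounds it, as well as the averaging error. *)
Theorem practical_stability p (A : 'M[R]_p) (kap : R) : lyapunov A -> 0 <= kap ->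
  exists rho M lam C : R, [/\ 0 < rho, 1 <= M, 0 < lam & 0 < C] /\
  forall (x : R -> 'cV[R]_p) (b : R),
    (forall i, continuous (fun t => x t i 0)) ->
    0 <= b -> M * enorm (x 0) + C * b < rho ->
    (forall T, 0 < T -> (forall t, 0 < t <= T -> enorm (x t) <= rho) ->
      exists w e : R -> 'cV[R]_p, forall t, 0 < t <= T ->
      [/\ enorm (w t) <= b, enorm (e t) <= kap * enorm (x t) ^+ 2 + b &
          forall i, is_derive t 1 (fun t => (x t - w t) i 0) ((A *m x t + e t) i 0)]) ->
    forall t, 0 <= t ->
      enorm (x t) < rho /\
      enorm (x t) <= M * expR (- lam * t) * enorm (x 0) + C * b.
Proof.
move=> lA kap0; have [eta [M [lam [C [[eta0 M1 lam0 C0] est]]]]] := lyapunov_estimate lA.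
have [al al0 alP] := enorm_mulmx A.
(* In the ball of radius [rho] the quadratic term is at most [eta * enorm (x u)]. In [C'], [M] pays
   for [w] at the initial time, the middle term for the forcing of [x - w], and [1] for [w] at the
   final time. *)
pose rho := eta / (kap + 1); pose C' := M + C * (al + 1 + eta) + 1.
have M0 : 0 < M by exact: lt_le_trans M1.
have kap1 : 0 < kap + 1 by rewrite ltr_wpDl.
have rho0 : 0 < rho by rewrite divr_gt0.
have kaprho : kap * rho <= eta.
  by rewrite /rho mulrCA ger_pMr// ler_pdivrMr// mul1r lerDl.
have C'0 : 0 < C' by rewrite !addr_gt0 ?mulr_gt0 ?addr_gt0.
exists rho, M, lam, C'; split=> // x b cx b0 xb avg.
have cnx := continuous_enorm cx.
have dec t : 0 <= t -> expR (- lam * t) <= 1.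
  by move=> t0; rewrite -[leRHS]expR0 ler_expR mulNr oppr_le0 pmulr_rge0.
(* [w] is controlled only at positive times, so the estimate starts from some [s > 0]; [from_0] then
   reaches [0] by continuity of [x]. *)
have from_s T : 0 < T -> (forall t, 0 < t <= T -> enorm (x t) <= rho) ->
    forall s, 0 < s <= T ->
      enorm (x T) <= M * expR (- lam * (T - s)) * enorm (x s) + C' * b.
  move=> T0 ball s /andP[s0 sT]; have [w [e we]] := avg _ T0 ball.
  pose y u := x u - w u; pose r u := A *m w u + e u.
  have xw u : 0 < u <= T -> enorm (x u) <= enorm (y u) + b.
    move=> /we[wb _ _]; rewrite -{1}(subrK (w u) (x u)) (le_trans (enormD _ _))//.
    by rewrite lerD2l.
  have wx u : 0 < u <= T -> enorm (y u) <= enorm (x u) + b.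
    by move=> /we[wb _ _]; rewrite (le_trans (enormD _ _))// enormN lerD2l.
  have b1 : 0 <= (al + 1 + eta) * b by rewrite mulr_ge0// !addr_ge0// ltW.
  have yT : enorm (y T) <= M * expR (- lam * (T - s)) * enorm (y s) + C * ((al + 1 + eta) * b).
    apply: (est y r) => // u /andP[su uT]; have uT' : 0 < u <= T by rewrite uT (lt_le_trans s0).
    have [wb eb dy] := we u uT'; split.
      move=> i; have := dy i; congr (is_derive _ _ _ (fun_of_matrix _ _ _)).
      by rewrite /y /r mulmxBr addrA subrK.
    rewrite /r (le_trans (enormD _ _))//.
    apply: (@le_trans _ _ (al * b + (eta * enorm (x u) + b))).
      apply: lerD; first by rewrite (le_trans (alP _))// ler_pM2l.
      rewrite (le_trans eb)// lerD2r expr2 mulrA ler_wpM2r ?enorm_ge0//.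
      by rewrite (le_trans _ kaprho)// ler_wpM2l// ball.
    by have := ler_wpM2l (ltW eta0) (xw u uT'); lra.
  have TT : 0 < T <= T by rewrite T0 lexx.
  have sT' : 0 < s <= T by rewrite s0.
  have E1 := dec (T - s) ltac:(by rewrite subr_ge0).
  apply: (le_trans (xw _ TT)); rewrite (le_trans (lerD yT (lexx b)))//.
  have ME0 : 0 <= M * expR (- lam * (T - s)) by rewrite mulr_ge0 ?expR_ge0 ?ltW.
  have := ler_wpM2l ME0 (wx _ sT').
  have : M * expR (- lam * (T - s)) * b <= M * b.
    by rewrite ler_wpM2r// ger_pMr.
  by rewrite /C'; lra.
have from_0 T : 0 < T -> (forall t, 0 < t <= T -> enorm (x t) <= rho) ->
    enorm (x T) <= M * expR (- lam * T) * enorm (x 0) + C' * b.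
  move=> T0 ball; rewrite leNgt; apply/negP.
  pose h s := M * expR (lam * s - lam * T) * enorm (x s) + C' * b.
  have -> : M * expR (- lam * T) * enorm (x 0) + C' * b = h 0.
    by rewrite /h mulr0 add0r mulNr.
  have ch : {for 0, continuous h}.
    apply: continuousD; last exact: cst_continuous.
    apply: continuousM; last exact: cnx.
    apply: continuousM; first exact: cst_continuous.
    apply: continuous_comp; last exact: continuous_expR.
    apply: continuousB; last exact: cst_continuous.
    by apply: continuousM; [exact: cst_continuous|exact: cvg_id].
  move=> /(continuous_near_lt ch)[d d0 dP].
  pose s := Num.min (d / 2) T.
  have s0 : 0 < s by rewrite lt_min T0 divr_gt0.
  have sT : 0 < s <= T by rewrite s0 ge_min lexx orbT.
  have : h s < enorm (x T).
    by apply: dP; rewrite subr0 gtr0_norm// gt_min; apply/orP; left; lra.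
  rewrite ltNge /h => /negP; apply.
  have -> : lam * s - lam * T = - lam * (T - s) by ring.
  exact: from_s.
have inball : forall t, 0 <= t -> enorm (x t) < rho.
  apply: bootstrap => // [|T T0 ball].
    apply: le_lt_trans xb; rewrite ler_wpDr//; first by rewrite mulr_ge0// ltW.
    by rewrite ler_peMl ?enorm_ge0.
  apply: le_lt_trans (from_0 _ T0 ball) _; apply: le_lt_trans xb.
  rewrite lerD2r ler_wpM2r ?enorm_ge0// ger_pMr//; exact/dec/ltW.
move=> t t0; split; first exact: inball.
move: t0; rewrite le_eqVlt => /predU1P[<-|t0].
  rewrite mulr0 expR0 mulr1 ler_wpDr//; first by rewrite mulr_ge0// ltW.
  by rewrite ler_peMl ?enorm_ge0.
by apply: from_0 => // u /andP[u0 _]; apply/ltW/inball/ltW.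
Qed.

End PracticalStability.

(** * Existence of solutions *)

Section Picard.
Variable R : realType.

Lemma cont_add (f g : R -> R) : continuous f -> continuous g ->
  continuous (fun t => f t + g t).
Proof. by move=> cf cg t; exact: continuousD (cf t) (cg t). Qed.

Lemma cont_sub (f g : R -> R) : continuous f -> continuous g ->
  continuous (fun t => f t - g t).
Proof. by move=> cf cg t; exact: continuousB (cf t) (cg t). Qed.

Lemma cont_mul (f g : R -> R) : continuous f -> continuous g ->
  continuous (fun t => f t * g t).
Proof. by move=> cf cg t; exact: continuousM (cf t) (cg t). Qed.

Lemma cont_comp (f g : R -> R) : continuous f -> continuous g ->
  continuous (fun t => g (f t)).
Proof. by move=> cf cg t; exact: continuous_comp (cf t) (cg _). Qed.

Lemma cont_cst (c : R) : continuous (fun _ : R => c).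
Proof. by move=> t; exact: cst_continuous. Qed.

Lemma cont_id : continuous (fun t : R => t).
Proof. by move=> t; exact: cvg_id. Qed.

Lemma antiderivative (g : R -> R) : continuous g ->
  exists G : R -> R, [/\ G 0 = 0, continuous G &
    forall t : R, 0 < t -> is_derive t 1 G (g t)].
Proof.
move=> cg.
(* Starting at [-1] makes [0] an interior point, where [F] is therefore continuous; the
   antiderivative is then frozen at negative times. *)
pose F x := (\int[lebesgue_measure]_(t in [set` `[-1, x]]) (g t))%R.
have dF (x : R) : -1 < x -> is_derive x 1 F (g x).
  move=> x1; have xx : x < x + 1 by rewrite ltrDl.
  have ig : lebesgue_measure.-integrable `[-1, x + 1] (EFin \o g).
    apply: continuous_compact_integrable; first exact: segment_compact.
    exact: continuous_subspaceT.
  have [dF Fg] := continuous_FTC1_closed xx ig x1 (cg x).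
  by rewrite -Fg derive1E; exact: derivableP.
clearbody F.
exists (fun t => F (Num.max t 0) - F 0); split.
- by rewrite maxxx subrr.
- move=> t; apply: continuousB; last exact: cst_continuous.
  apply: (@continuous_comp R R R (fun t : R => Num.max t 0 : R) F).
    by apply: continuous_max; [exact: cvg_id|exact: cst_continuous].
  have [] := dF (Num.max t 0) _; first by rewrite lt_max ltrN10 orbT.
  by move=> /derivable1_diffP/differentiable_continuous.
- move=> t t0; have dFt := dF t (lt_trans (ltrN10 _) t0).
  apply: (@near_eq_is_derive _ _ _ (fun t => F t - F 0)).
  + near=> u; rewrite max_l//; near: u; exact: lt_le_nbhsr.
  + by have := is_deriveB dFt (is_derive_cst (F 0) t (1 : R)); rewrite subr0.
Unshelve. all: by end_near. Qed.

Lemma le_of_geometric (a b c : R) :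
  (forall k, a <= b + (2^-1) ^+ k * c) -> a <= b.
Proof.
move=> h; rewrite leNgt; apply/negP => ba.
have c0 : 0 < c by have := h 0%N; rewrite expr0 mul1r; lra.
have e0 : 0 < (a - b) / c by rewrite divr_gt0// subr_gt0.
have [k _ /(_ k (leqnn k))] := near_infty_natSinv_expn_lt (PosNum e0).
rewrite /= mul1r -exprVn ltr_pdivlMr// => hk.
by have := h k; lra.
Qed.

(** The intervals of centre [u k] and radius [d k] are nested because [d k = 2 * d k.+1]; the limit
    is the supremum of their left ends. *)
Lemma seq_limit (u : nat -> R) (E : R) : 0 <= E ->
  (forall k, `|u k.+1 - u k| <= (2^-1) ^+ k * E) ->
  exists l, forall k, `|u k - l| <= 2 * ((2^-1) ^+ k * E).
Proof.
move=> E0 uE.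
pose d k := 2 * ((2^-1) ^+ k * E).
have d0 k : 0 <= d k by rewrite !mulr_ge0.
have dS k : d k = 2 * d k.+1 by rewrite /d exprS; field.
have uS k : `|u k.+1 - u k| <= d k.+1.
  by have := uE k; have := dS k; rewrite /d; lra.
have low k m : u k - d k <= u (k + m)%N - d (k + m)%N.
  elim: m => [|m IH]; first by rewrite addn0.
  apply: (le_trans IH); rewrite addnS.
  have := uS (k + m)%N; rewrite ler_norml => /andP[+ _].
  by have := dS (k + m)%N; lra.
have up k m : u (k + m)%N + d (k + m)%N <= u k + d k.
  elim: m => [|m IH]; first by rewrite addn0.
  apply: le_trans IH; rewrite addnS.
  have := uS (k + m)%N; rewrite ler_norml => /andP[_].
  by have := dS (k + m)%N; lra.
have lowup j k : u j - d j <= u k + d k.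
  have := low j k; have := up k j; rewrite addnC; have := d0 (j + k)%N; lra.
pose S : set R := [set u k - d k | k in setT].
have S0 : S !=set0 by exists (u 0%N - d 0%N), 0%N.
exists (sup S) => k; rewrite ler_norml; apply/andP; split.
  have : sup S <= u k + d k by apply: ge_sup => // _ [j _ <-].
  by rewrite -/(d k); lra.
have : u k - d k <= sup S.
  by apply: ub_le_sup; [exists (u 0%N + d 0%N) => _ [j _ <-]|exists k].
by rewrite -/(d k); lra.
Qed.

(** Under the weight [expR (2 * K * t)], integrating a [K]-Lipschitz field halves distances: this is
    the contraction behind [picard], valid on the whole half-line. Monotonicity compares both [h]
    and [- h] with the weight. *)
Lemma exp_comparison (h dh : R -> R) (K c : R) : 0 < K -> 0 <= c ->
  continuous h -> h 0 = 0 -> (forall t : R, 0 < t -> is_derive t 1 h (dh t)) ->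
  (forall t : R, 0 < t -> `|dh t| <= K * (2 * c * expR (2 * K * t))) ->
  forall t : R, 0 <= t -> `|h t| <= c * expR (2 * K * t).
Proof.
move=> K0 c0 ch h0 hdh dhle t t0.
have side (s : R) : `|s| <= 1 -> 0 <= c * expR (2 * K * t) - s * h t.
  move=> s1; pose W u := c * expR (2 * K * u) - s * h u.
  have dW (u : R) : 0 < u -> is_derive u 1 W (c * (expR (2 * K * u) * (2 * K)) - s * dh u).
    move=> u0; apply: is_deriveB; apply: is_deriveZ; first exact: is_derive_expR_lin.
    exact: hdh.
  have cW : {within `[0, t], continuous W}.
    apply: continuous_subspaceT; apply: cont_sub.
      apply: cont_mul; first exact: cont_cst.
      apply: cont_comp; last exact: continuous_expR.
      by apply: cont_mul; [exact: cont_cst|exact: cont_id].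
    by apply: cont_mul => //; exact: cont_cst.
  have dW' (u : R) : u \in `]0, t[ -> is_derive u 1 W (c * (expR (2 * K * u) * (2 * K)) - s * dh u).
    by rewrite in_itv/= => /andP[u0 _]; exact: dW.
  move: t0; rewrite le_eqVlt => /predU1P[<-|t0].
    by rewrite h0 !mulr0 subr0 expR0 mulr1.
  have [u] := MVT t0 dW' cW; rewrite in_itv/= => /andP[u0 ut] WE.
  apply: (@le_trans _ _ (W 0)); first by rewrite /W h0 !mulr0 subr0 expR0 mulr1.
  rewrite -/(W t) -subr_ge0 WE subr0 pmulr_lge0// subr_ge0.
  apply: (le_trans (ler_norm _)); rewrite normrM.
  apply: (@le_trans _ _ (1 * `|dh u|)); first by rewrite ler_wpM2r.
  by rewrite mul1r (le_trans (dhle _ u0))// le_eqVlt; apply/orP; left; apply/eqP; ring.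
have := side 1 ltac:(by rewrite normr1); have := side (-1) ltac:(by rewrite normrN1).
by rewrite ler_norml; lra.
Qed.

(** Boundedness gives all iterates the Lipschitz constant [K] in time; it passes to the limit, which
    is thus continuous. The solution returned is one more iterate of this limit: it agrees with it
    at nonnegative times and is differentiable by construction. *)
Theorem picard p (f : R -> 'cV[R]_p -> 'cV[R]_p) (K : R) (x0 : 'cV[R]_p) : 0 < K ->
  (forall t (x : 'cV[R]_p) i, `|f t x i 0| <= K) ->
  (forall t (x y : 'cV[R]_p) d, (forall j, `|x j 0 - y j 0| <= d) ->
    forall i, `|f t x i 0 - f t y i 0| <= K * d) ->
  (forall x : R -> 'cV[R]_p, (forall i, continuous (fun t => x t i 0)) ->
    forall i, continuous (fun t => f t (x t) i 0)) ->
  exists x : R -> 'cV[R]_p, [/\ x 0 = x0, forall i, continuous (fun t => x t i 0) &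
    forall t : R, 0 < t -> forall i, is_derive t 1 (fun t => x t i 0) (f t (x t) i 0)].
Proof.
move=> K0 fK fL fC.
pose C (x : R -> 'cV[R]_p) := forall i, continuous (fun t => x t i 0).
pose next (x y : R -> 'cV[R]_p) := [/\ y 0 = x0, C y &
  forall t : R, 0 < t -> forall i, is_derive t 1 (fun t => y t i 0) (f t (x t) i 0)].
have nextP x : C x -> exists y, next x y.
  move=> Cx; have /choice[G GP] i := antiderivative (fC x Cx i).
  have cE i : (fun t => (\col_i (x0 i 0 + G i t)) i 0) = (fun t => x0 i 0 + G i t).
    by apply/funext => t; rewrite mxE.
  exists (fun t => \col_i (x0 i 0 + G i t)); split.
  - apply/matrixP => i j; rewrite (ord1 j) mxE; have [-> _ _] := GP i.
    by rewrite addr0.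
  - move=> i; rewrite cE; apply: cont_add; first exact: cont_cst.
    by have [_ cG _] := GP i.
  - move=> t t0 i; rewrite cE; have [_ _ /(_ t t0) dG] := GP i.
    by have := is_deriveD (is_derive_cst (x0 i 0) t (1 : R)) dG; rewrite add0r.
(* [S] is the Picard map, with a dummy value on discontinuous curves. *)
have /choice[S SP] : forall x, exists y, C x -> next x y.
  move=> x; have [/nextP[y xy]|nCx] := pselect (C x); first by exists y.
  by exists x.
pose X k := iter k S (cst x0).
have CX k : C (X k).
  by elim: k => [|k IH]; [move=> i t; exact: cst_continuous|have [] := SP _ IH].
have X0 k : X k 0 = x0.
  by case: k => [//|k]; have [] := SP _ (CX k).
have dX k (t : R) : 0 < t -> forall i, is_derive t 1 (fun t => X k.+1 t i 0) (f t (X k t) i 0).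
  by have [_ _] := SP _ (CX k); exact.
pose E (t : R) := expR (2 * K * t).
have E0 t : 0 < E t by exact: expR_gt0.
have h0 k : 0 < (2^-1 : R) ^+ k by rewrite exprn_gt0.
have cB (y z : R -> 'cV[R]_p) i : C y -> C z -> continuous (fun t => y t i 0 - z t i 0).
  by move=> Cy Cz; apply: cont_sub; [exact: Cy|exact: Cz].
have geom k (t : R) i : 0 <= t -> `|X k.+1 t i 0 - X k t i 0| <= (2^-1) ^+ k * E t.
  elim: k t i => [|k IH] t i t0.
    apply: (@exp_comparison (fun t => X 1%N t i 0 - X 0%N t i 0)
      (fun t => f t x0 i 0) K ((2^-1) ^+ 0) K0 _ _ _ _ _ t t0).
    - by rewrite expr0.
    - exact: cB.
    - by rewrite !X0 subrr.
    - move=> u u0; have := is_deriveB (dX 0%N u u0 i) (is_derive_cst (x0 i 0) u (1 : R)).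
      by rewrite subr0.
    - move=> u u0; apply: (le_trans (fK _ _ _)); rewrite expr0 mulr1 ler_peMr ?ltW//.
      have : 1 <= expR (2 * K * u) by rewrite -[leLHS]expR0 ler_expR !mulr_ge0 ?ltW.
      by lra.
  apply: (@exp_comparison (fun t => X k.+2 t i 0 - X k.+1 t i 0)
    (fun t => f t (X k.+1 t) i 0 - f t (X k t) i 0) K ((2^-1) ^+ k.+1) K0 _ _ _ _ _ t t0).
  - exact/ltW.
  - exact: cB.
  - by rewrite !X0 subrr.
  - move=> u u0; exact: is_deriveB (dX _ u u0 i) (dX _ u u0 i).
  - move=> u u0; apply: fL => j; apply: (le_trans (IH _ _ (ltW u0))).
    by rewrite exprS mulrA divff// mul1r.
have /choice[l lP] : forall ti : R * 'I_p, exists l, 0 <= ti.1 ->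
    forall k, `|X k ti.1 ti.2 0 - l| <= 2 * ((2^-1) ^+ k * E ti.1).
  move=> [t i]/=; have [t0|nt0] := pselect (0 <= t); last by exists 0.
  have [l lP] := seq_limit (ltW (E0 t)) (fun k => geom k t i t0).
  by exists l.
pose x (t : R) : 'cV[R]_p := \col_i l (Num.max t 0, i).
have xP k (t : R) i : 0 <= t -> `|X k t i 0 - x t i 0| <= 2 * ((2^-1) ^+ k * E t).
  by move=> t0; rewrite mxE max_l//; exact: (lP (t, i)).
have XL k (s t : R) i : 0 <= s -> s <= t -> `|X k t i 0 - X k s i 0| <= K * (t - s).
  move=> s0 st; case: k => [|k].
    by rewrite subrr normr0 mulr_ge0 ?subr_ge0// ltW.
  have dXi (u : R) : u \in `]s, t[ -> is_derive u 1 (fun t => X k.+1 t i 0) (f u (X k u) i 0).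
    by rewrite in_itv/= => /andP[su _]; apply: dX; exact: le_lt_trans su.
  have [|u _ ->] := MVT_segment st dXi; first by apply: continuous_subspaceT; exact: CX.
  by rewrite normrM (ger0_norm (_ : 0 <= t - s)) ?subr_ge0// ler_wpM2r ?subr_ge0.
have xL (s t : R) i : 0 <= s -> s <= t -> `|x t i 0 - x s i 0| <= K * (t - s).
  move=> s0 st; apply: (@le_of_geometric _ _ (2 * E t + 2 * E s)) => k.
  have t0 : 0 <= t by exact: le_trans st.
  have := xP k t i t0; have := xP k s i s0; have := XL k s t i s0 st.
  by rewrite !ler_norml; lra.
have Cx : C x.
  move=> i t; apply/cvgrPdist_le => e e0; near=> u.
  have xmax (v : R) : x v = x (Num.max v 0).
    by apply/matrixP => a b; rewrite !mxE [Num.max (Num.max v 0) 0]max_l// le_max lexx orbT.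
  have maxL (v w : R) : v <= w -> Num.max w 0 - Num.max v 0 <= w - v.
    by move=> vw; rewrite /Num.max; case: (ltP v 0) => ?; case: (ltP w 0) => ?; lra.
  have xL' (v w : R) : v <= w -> `|x w i 0 - x v i 0| <= K * (w - v).
    move=> vw; rewrite (xmax v) (xmax w); apply: (le_trans (xL _ _ _ _ _)).
    - by rewrite le_max lexx orbT.
    - by rewrite ge_max !le_max vw lexx !orbT.
    - by rewrite ler_pM2l// maxL.
  have : `|x t i 0 - x u i 0| <= K * `|t - u|.
    have [tu|/ltW ut] := leP t u.
      by rewrite distrC [`|t - u|]distrC (ger0_norm (_ : 0 <= u - t)) ?subr_ge0// xL'.
    by rewrite (ger0_norm (_ : 0 <= t - u)) ?subr_ge0// xL'.
  move=> h; apply: (le_trans h); rewrite mulrC -ler_pdivlMr//.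
  near: u; apply: cvgr_dist_le; [exact: cvg_id|exact: divr_gt0].
have [SX0 CSx dSx] := SP _ Cx.
have SxE (t : R) : 0 <= t -> S x t = x t.
  move=> t0; apply/matrixP => i j; rewrite (ord1 j) {j}.
  apply/eqP; rewrite -subr_eq0 -normr_le0; apply: (@le_of_geometric _ _ (2 * E t)) => k.
  have h1 : `|S x t i 0 - X k.+1 t i 0| <= (2^-1) ^+ k * E t.
    apply: (@exp_comparison (fun t => S x t i 0 - X k.+1 t i 0)
      (fun t => f t (x t) i 0 - f t (X k t) i 0) K ((2^-1) ^+ k) K0 _ _ _ _ _ t t0).
    - exact/ltW.
    - exact: cB.
    - by rewrite SX0 X0 subrr.
    - move=> u u0; exact: is_deriveB (dSx u u0 i) (dX _ u u0 i).
    - move=> u u0; apply: fL => j; rewrite distrC -mulrA; apply: xP; exact: ltW.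
  have := xP k.+1 t i t0; rewrite exprS.
  move: h1; rewrite !ler_norml; lra.
exists (S x); split=> // t t0 i; rewrite SxE ?ltW//; exact: dSx.
Unshelve. all: by end_near. Qed.

End Picard.

(** * Averaging along trajectories *)

Section Averaging.
Variables (R : realType) (Th : Type) (D : Th -> R -> Prop) (om : Th -> R).
Hypothesis om_gt0 : forall th, 0 < om th.
Implicit Types c f F : Th -> R -> R.

(* The bounds below are uniform in the parameter [th], which will range over
   pairs of a frequency and a trajectory observed on a time domain [D th]. *)
Definition slow c : Prop := exists dc (K : R), forall th t, D th t ->
  [/\ `|c th t| <= K, `|dc th t| <= K & is_derive t 1 (c th) (dc th t)].

(** [w] is the corrector of first-order averaging: subtracted from a trajectory driven by [F], it
    leaves the drift [Fb - e]. *)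
Definition averages F Fb : Prop := exists K : R, forall th,
  exists w e : R -> R, forall t : R, D th t ->
  [/\ `|w t| <= K / om th, `|e t| <= K / om th &
      is_derive t 1 w (F th t - Fb th t + e t)].

Lemma slow_cst (k : R) : slow (fun _ _ => k).
Proof.
exists (fun _ _ => 0), `|k| => th t _; rewrite normr0.
by split => //; exact: is_derive_cst.
Qed.

Lemma slow_add c f : slow c -> slow f -> slow (fun th t => c th t + f th t).
Proof.
move=> [dc [K cK]] [df [L fL]]; exists (fun th t => dc th t + df th t), (K + L).
move=> th t Dt; have [c1 c2 c3] := cK th t Dt; have [f1 f2 f3] := fL th t Dt.
split; [| |exact: is_derive_add].
- by rewrite (le_trans (ler_normD _ _))// lerD.
- by rewrite (le_trans (ler_normD _ _))// lerD.
Qed.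

Lemma slow_mul c f : slow c -> slow f -> slow (fun th t => c th t * f th t).
Proof.
move=> [dc [K cK]] [df [L fL]].
exists (fun th t => dc th t * f th t + c th t * df th t), (K * L + K * L).
move=> th t Dt; have [c1 c2 c3] := cK th t Dt; have [f1 f2 f3] := fL th t Dt.
have K0 : 0 <= K by exact: le_trans c1.
have L0 : 0 <= L by exact: le_trans f1.
split; [| |exact: is_derive_mul].
- by rewrite normrM (@le_trans _ _ (K * L)) ?ler_pM// lerDl mulr_ge0.
- by rewrite (le_trans (ler_normD _ _))// !normrM lerD// ler_pM.
Qed.

Lemma slow_sum (I : finType) (P : pred I) (c : I -> Th -> R -> R) :
  (forall i, slow (c i)) -> slow (fun th t => \sum_(i | P i) c i th t).
Proof.
move=> cs; elim: (index_enum I) => [|i r IH].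
  have -> : (fun th t => \sum_(i <- [::] | P i) c i th t) = (fun _ _ => 0).
    by apply/funext => th; apply/funext => t; rewrite big_nil.
  exact: slow_cst.
have [Pi|nPi] := boolP (P i).
  have -> : (fun th t => \sum_(i <- i :: r | P i) c i th t) =
      (fun th t => c i th t + \sum_(i <- r | P i) c i th t).
    by apply/funext => th; apply/funext => t; rewrite big_cons Pi.
  exact: slow_add.
have -> : (fun th t => \sum_(i <- i :: r | P i) c i th t) =
    (fun th t => \sum_(i <- r | P i) c i th t).
  by apply/funext => th; apply/funext => t; rewrite big_cons (negbTE nPi).
exact: IH.
Qed.

Lemma avg_id F : averages F F.
Proof.
exists 0 => th; exists (fun _ => 0), (fun _ => 0) => t _.
by rewrite normr0 mul0r subrr addr0; split => //; exact: is_derive_cst.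
Qed.

Lemma avg_ext F F' Fb Fb' : (forall th t, F th t = F' th t) ->
  (forall th t, Fb th t = Fb' th t) -> averages F Fb -> averages F' Fb'.
Proof.
move=> FF' FbFb' [K h]; exists K => th; have [w [e we]] := h th.
by exists w, e => t; rewrite -FF' -FbFb'; exact: we.
Qed.

Lemma avg_add F G Fb Gb : averages F Fb -> averages G Gb ->
  averages (fun th t => F th t + G th t) (fun th t => Fb th t + Gb th t).
Proof.
move=> [K hF] [L hG]; exists (K + L) => th.
have [w [e we]] := hF th; have [w' [e' we']] := hG th.
exists (fun t => w t + w' t), (fun t => e t + e' t) => t Dt.
have [w1 e1 d1] := we t Dt; have [w2 e2 d2] := we' t Dt.
rewrite mulrDl; split.
- by rewrite (le_trans (ler_normD _ _))// lerD.
- by rewrite (le_trans (ler_normD _ _))// lerD.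
- by apply: (is_derive_eq (is_derive_add d1 d2)); ring.
Qed.

(** Product rule: [c * w] corrects [c * F], and the extra [dc * w] joins the error, since [dc] is
    bounded and [w] is of order [1 / om]. *)
Lemma avg_mul c F Fb : slow c -> averages F Fb ->
  averages (fun th t => c th t * F th t) (fun th t => c th t * Fb th t).
Proof.
move=> [dc [K cK]] [L hF]; exists (K * L + K * L) => th.
have [w [e we]] := hF th.
exists (fun t => c th t * w t), (fun t => dc th t * w t + c th t * e t) => t Dt.
have [w1 e1 d1] := we t Dt; have [c1 c2 d2] := cK th t Dt.
have K0 : 0 <= K by exact: le_trans c1.
have L0 : 0 <= L / om th by exact: le_trans w1.
rewrite mulrDl -mulrA; split.
- by rewrite normrM (@le_trans _ _ (K * (L / om th))) ?ler_pM// lerDl mulr_ge0.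
- by rewrite (le_trans (ler_normD _ _))// !normrM lerD// ler_pM.
- by apply: (is_derive_eq (is_derive_mul d2 d1)); ring.
Qed.

Lemma avg_sum (I : finType) (F Fb : I -> Th -> R -> R) :
  (forall i, averages (F i) (Fb i)) ->
  averages (fun th t => \sum_i F i th t) (fun th t => \sum_i Fb i th t).
Proof.
move=> FFb; elim: (index_enum I) => [|i r IH].
  apply: avg_ext (avg_id (fun _ _ => 0)); by move=> th t; rewrite big_nil.
apply: avg_ext (avg_add (FFb i) IH); by move=> th t; rewrite big_cons.
Qed.

Lemma avg_osc (phi Phi : R -> R) (mu B : R) :
  (forall s : R, is_derive s 1 Phi (phi s - mu)) -> (forall s, `|Phi s| <= B) ->
  averages (fun th t => phi (om th * t)) (fun _ _ => mu).
Proof.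
move=> dPhi PhiB; exists B => th.
have B0 : 0 <= B by exact: le_trans (PhiB 0).
exists (fun t => (om th)^-1 * Phi (om th * t)), (fun _ => 0) => t _.
have om0 : 0 <= (om th)^-1 by rewrite invr_ge0 ltW.
rewrite normr0 addr0; split; last first.
- have := is_deriveZ (om th)^-1 (is_derive1_comp (dPhi (om th * t)) (is_derive_lin (om th) t)).
  move=> d; apply: (is_derive_eq d); rewrite /GRing.scale/=.
  by rewrite mulrCA mulVf ?mulr1// gt_eqF.
- by rewrite mulr_ge0.
- by rewrite normrM ger0_norm// mulrC ler_wpM2r.
Qed.

(** The zero frequency is no exception here, unlike in [avg_cos], because the sine itself
    vanishes. *)
Lemma avg_sin (nu : R) : averages (fun th t => sin (om th * nu * t)) (fun _ _ => 0).
Proof.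
have [->|nu0] := eqVneq nu 0.
  by apply: avg_ext (avg_id (fun _ _ => 0)) => // th t; rewrite mulr0 mul0r sin0.
suff : averages (fun th t => sin (nu * (om th * t))) (fun _ _ => 0).
  apply: avg_ext => // th t; congr sin; ring.
apply: (@avg_osc (fun s => sin (nu * s)) (fun s => - nu^-1 * cos (nu * s)) 0 `|nu^-1|).
- move=> s; have := is_deriveZ (- nu^-1)
    (is_derive1_comp (is_derive_cos (nu * s)) (is_derive_lin nu s)).
  by move=> d; apply: (is_derive_eq d); rewrite /GRing.scale/=; field.
- move=> s; rewrite normrM normrN ler_piMr//.
  by rewrite ler_norml cos_geN1 cos_le1.
Qed.

Lemma avg_cos (nu : R) :
  averages (fun th t => cos (om th * nu * t)) (fun _ _ => (nu == 0)%:R).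
Proof.
have [->|nu0] := eqVneq nu 0.
  by apply: avg_ext (avg_id (fun _ _ => 1)) => // th t; rewrite mulr0 mul0r cos0.
suff : averages (fun th t => cos (nu * (om th * t))) (fun _ _ => 0).
  apply: avg_ext => // th t; congr cos; ring.
apply: (@avg_osc (fun s => cos (nu * s)) (fun s => nu^-1 * sin (nu * s)) 0 `|nu^-1|).
- move=> s; have := is_deriveZ (nu^-1)
    (is_derive1_comp (is_derive_sin (nu * s)) (is_derive_lin nu s)).
  by move=> d; apply: (is_derive_eq d); rewrite /GRing.scale/=; field.
- move=> s; rewrite normrM ler_piMr//.
  by rewrite ler_norml sin_geN1 sin_le1.
Qed.

Variables (I : finType) (nu : I -> R).
Hypothesis nu_gt0 : forall i, 0 < nu i.
Hypothesis nu_inj : injective nu.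
Let s i th t := sin (om th * nu i * t).

(** Of the two cosines in the product formula, only the one at the difference of the frequencies can
    be constant, and by injectivity only when [i = j]. *)
Lemma avg_sin2 i j :
  averages (fun th t => s i th t * s j th t) (fun _ _ => (i == j)%:R / 2).
Proof.
have := avg_add (avg_mul (slow_cst (2^-1)) (avg_cos (nu i - nu j)))
                (avg_mul (slow_cst (- 2^-1)) (avg_cos (nu i + nu j))).
apply: avg_ext => th t.
  have -> : om th * (nu i - nu j) * t = om th * nu i * t - om th * nu j * t by ring.
  have -> : om th * (nu i + nu j) * t = om th * nu i * t + om th * nu j * t by ring.
  by rewrite cosB cosD /s; field.
rewrite subr_eq0 (inj_eq nu_inj) gt_eqF ?addr_gt0// mulr0 addr0 mulrC //.
Qed.

(** A product of three sines is a combination of four sines, so a resonance such as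
    [nu i + nu j = nu k] contributes the zero function and not a constant. *)
Lemma avg_sin3 i j k :
  averages (fun th t => s i th t * s j th t * s k th t) (fun _ _ => 0).
Proof.
have A (c v : R) := avg_mul (slow_cst c) (avg_sin v).
have := avg_add (avg_add (A 4^-1 (nu i + nu j - nu k)) (A 4^-1 (nu j + nu k - nu i)))
  (avg_add (A 4^-1 (nu k + nu i - nu j)) (A (- 4^-1) (nu i + nu j + nu k))).
apply: avg_ext => th t; last by rewrite !mulr0 !addr0.
have -> : om th * (nu i + nu j - nu k) * t =
  om th * nu i * t + om th * nu j * t - om th * nu k * t by ring.
have -> : om th * (nu j + nu k - nu i) * t =
  om th * nu j * t + om th * nu k * t - om th * nu i * t by ring.
have -> : om th * (nu k + nu i - nu j) * t =
  om th * nu k * t + om th * nu i * t - om th * nu j * t by ring.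
have -> : om th * (nu i + nu j + nu k) * t =
  om th * nu i * t + om th * nu j * t + om th * nu k * t by ring.
rewrite !sinB !sinD !cosD /s.
set x := om th * nu i * t; set y := om th * nu j * t; set z := om th * nu k * t.
by field.
Qed.

Lemma quad_expand (al ga : R) (be et sn : I -> R) :
  (al + \sum_l be l * sn l) * (ga + \sum_l et l * sn l) =
  al * ga + (\sum_l (al * et l + ga * be l) * sn l +
             \sum_l \sum_l' (be l * et l') * (sn l * sn l')).
Proof.
rewrite mulrDl !mulrDr -addrA; congr (_ + _); rewrite addrA; congr (_ + _).
  rewrite mulr_sumr mulr_suml -big_split; apply: eq_bigr => l _ /=; ring.
rewrite mulr_suml; apply: eq_bigr => l _; rewrite mulr_sumr.
by apply: eq_bigr => l' _; ring.
Qed.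

Section Quadratic.
Variables (al ga : Th -> R -> R) (be et : I -> Th -> R -> R).
Hypotheses (al_slow : slow al) (ga_slow : slow ga).
Hypotheses (be_slow : forall l, slow (be l)) (et_slow : forall l, slow (et l)).

Lemma avg_quad :
  averages (fun th t => (al th t + \sum_l be l th t * s l th t) *
                        (ga th t + \sum_l et l th t * s l th t))
    (fun th t => al th t * ga th t + 2^-1 * \sum_l be l th t * et l th t).
Proof.
have lin l : slow (fun th t => al th t * et l th t + ga th t * be l th t).
  by apply: slow_add; apply: slow_mul.
have bil l l' : slow (fun th t => be l th t * et l' th t) by apply: slow_mul.
have := avg_add (avg_id (fun th t => al th t * ga th t))
  (avg_add (avg_sum (fun l => avg_mul (lin l) (avg_sin (nu l))))
           (avg_sum (fun l => avg_sum (fun l' => avg_mul (bil l l') (avg_sin2 l l'))))).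
apply: avg_ext => th t; first by rewrite quad_expand.
congr (_ + _); rewrite big1 ?add0r => [|l _]; last by rewrite mulr0.
rewrite mulr_sumr; apply: eq_bigr => l _.
rewrite (bigD1 l)//= eqxx big1 ?addr0 => [|l' /negbTE ll']; first by rewrite mulrC mul1r.
by rewrite eq_sym ll' mul0r mulr0.
Qed.

(* Products of three sines have zero mean whatever the frequencies, because
   they are odd: this makes the averaged action dynamics exact. *)
Lemma avg_cubic i :
  averages (fun th t => (al th t + \sum_l be l th t * s l th t) *
                        (ga th t + \sum_l et l th t * s l th t) * s i th t)
    (fun th t => 2^-1 * (al th t * et i th t + ga th t * be i th t)).
Proof.
have lin l : slow (fun th t => al th t * et l th t + ga th t * be l th t).
  by apply: slow_add; apply: slow_mul.
have bil l l' : slow (fun th t => be l th t * et l' th t) by apply: slow_mul.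
have := avg_add (avg_mul (slow_mul al_slow ga_slow) (avg_sin (nu i)))
  (avg_add (avg_sum (fun l => avg_mul (lin l) (avg_sin2 l i)))
           (avg_sum (fun l => avg_sum (fun l' => avg_mul (bil l l') (avg_sin3 l l' i))))).
apply: avg_ext => th t.
  rewrite quad_expand !mulrDl; congr (_ + (_ + _)).
    by rewrite mulr_suml; apply: eq_bigr => l _; rewrite mulrA.
  rewrite mulr_suml; apply: eq_bigr => l _; rewrite mulr_suml.
  by apply: eq_bigr => l' _; rewrite !mulrA.
rewrite mulr0 add0r [X in _ + X]big1 ?addr0 => [|l _]; last first.
  by rewrite big1// => l' _; rewrite mulr0.
rewrite (bigD1 i)//= eqxx big1 ?addr0 => [|l /negbTE ->]; first by rewrite mulrC mul1r.
by rewrite mul0r mulr0.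
Qed.

End Quadratic.
End Averaging.

(** * The oligopoly and its linearization *)

Section OligopolyAlgebra.
Variables (R : realType) (N : nat) (r : 'I_N -> R) (Sd : R) (m : 'I_N -> R).
Variables (n : nat) (z : 'I_n -> 'I_N) (Dec : 'I_n -> {set 'I_N}).
Hypothesis Dec_self : forall k, z k \notin Dec k.
Variables (gain : 'I_N -> R) (epsd : 'I_n -> R).

Definition slope (i j : 'I_N) : R :=
  if j == i then - (Rpar r / (r i * Rbar r i)) else Rpar r / (r i * r j).

Lemma salesE i (u : 'cV[R]_N) :
  sales r Sd i u = Rpar r / r i * Sd + \sum_j slope i j * u j 0.
Proof.
rewrite /sales [in RHS](bigD1 i)//= /slope eqxx mulrDr mulrBr mulr_sumr addrA.
congr (_ + _ + _); first by rewrite invfM; ring.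
by apply: eq_bigr => j /negbTE ->; rewrite invfM; ring.
Qed.

Lemma salesD i (u w : 'cV[R]_N) :
  sales r Sd i (u + w) = sales r Sd i u + \sum_j slope i j * w j 0.
Proof.
rewrite !salesE -addrA; congr (_ + _); rewrite -big_split.
by apply: eq_bigr => j _; rewrite mxE mulrDr.
Qed.

(* The part due to deception of the coefficient of [a i * probe i] in the sales
   of player [i], see [slope_chi]. *)
Definition tilt i (d : 'cV[R]_n) : R := \sum_(k | i \in Dec k) d k 0 * slope i (z k).

Lemma tiltD i d d' : tilt i (d + d') = tilt i d + tilt i d'.
Proof. by rewrite -big_split; apply: eq_bigr => k _; rewrite mxE mulrDl. Qed.

Lemma tiltZ i h d : tilt i (h *: d) = h * tilt i d.
Proof. by rewrite mulr_sumr; apply: eq_bigr => k _; rewrite mxE mulrA. Qed.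

(** Deception amounts to player [i] differentiating its profit with its own slope shifted by [tilt].
    This is the form in which averaging delivers the drift. *)
Lemma pseudogradientE i (u : 'cV[R]_N) (d : 'cV[R]_n) :
  (Qbar r z Dec d *m u + Bbar r Sd m z Dec d) i 0 =
  - (sales r Sd i u + (u i 0 - m i) * (slope i i + tilt i d)).
Proof.
(* A deceiver of [i] is another player, so [slope] and [Q] are read in their off-diagonal cases. *)
have zi k : i \in Dec k -> (z k == i) = false.
  by move=> ik; apply/negP => /eqP zk; move: (Dec_self k); rewrite zk ik.
rewrite mxE [(_ *m _) i 0]mxE [(Bbar _ _ _ _ _ _) i 0]mxE.
have -> : \sum_j Qbar r z Dec d i j * u j 0 = \sum_j Q r i i j * u j 0 +
    \sum_(k | i \in Dec k) d k 0 * \sum_j Q r i (z k) j * u j 0.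
  under [X in _ = _ + X]eq_bigr do rewrite mulr_sumr.
  rewrite exchange_big/= -big_split; apply: eq_bigr => j _ /=.
  rewrite !mxE summxE mulrDl mulr_suml; congr (_ + _).
  by apply: eq_bigr => k _; rewrite !mxE mulrA.
have -> : \sum_j Q r i i j * u j 0 =
    - (\sum_j slope i j * u j 0) - slope i i * u i 0.
  rewrite [in LHS](bigD1 i)//= [in RHS](bigD1 i)//= !mxE !eqxx /slope eqxx.
  have -> : \sum_(j < N | j != i) Q r i i j * u j 0 =
      - \sum_(j < N | j != i) (if j == i then - (Rpar r / (r i * Rbar r i))
          else Rpar r / (r i * r j)) * u j 0.
    rewrite -sumrN; apply: eq_bigr => j /negbTE ji.
    by rewrite mxE eq_sym ji eqxx/= mulNr.
  by ring.
have -> : \sum_(k | i \in Dec k) d k 0 * (\sum_j Q r i (z k) j * u j 0) =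
    - (u i 0 * tilt i d).
  rewrite /tilt mulr_sumr -sumrN; apply: eq_bigr => k ik.
  rewrite (bigD1 i)//= big1 ?addr0 => [|j /negbTE ji].
    rewrite mxE (zi _ ik) eqxx orbT /slope (zi _ ik) (mulrC (r (z k))); ring.
  rewrite mxE (zi _ ik) ji/=.
  by case: (z k == j); rewrite mul0r.
have -> : \sum_(k | i \in Dec k) d k 0 * (m i * Rpar r / (r i * r (z k))) =
    m i * tilt i d.
  rewrite /tilt mulr_sumr; apply: eq_bigr => k ik.
  by rewrite /slope (zi _ ik); ring.
rewrite !mxE eqxx salesE {2}/slope {3}/slope !eqxx; ring.
Qed.

(** Exact, because [J] is quadratic; the last term is its quadratic part. *)
Lemma JD i (u w : 'cV[R]_N) : J r Sd m i (u + w) = J r Sd m i u +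
  (- (\sum_j slope i j * w j 0) * (u i 0 - m i) - sales r Sd i u * w i 0) -
  (\sum_j slope i j * w j 0) * w i 0.
Proof. by rewrite /J salesD mxE; ring. Qed.

End OligopolyAlgebra.

(** * Jacobian blocks and the derivative of the equilibrium branch *)

Section Linearization.
Variable R : realType.

(** An explicit error bound on difference quotients spares differentiating the matrix inverse in
    [ueq]. *)
Lemma deriveE_linear_error (V : normedModType R) (f : V -> R) (a v : V) (l C d : R) :
  0 < d -> 0 <= C ->
  (forall h : R, h != 0 -> `|h| < d -> `|h^-1 * (f (h *: v + a) - f a) - l| <= C * `|h|) ->
  'D_v f a = l.
Proof.
move=> d0 C0 err; apply: cvg_lim => //; apply/cvgrPdist_le => e e0.
near=> h; rewrite distrC; apply: (le_trans (err h _ _)).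
- by near: h; exact: nbhs_dnbhs_neq.
- by near: h; exact: dnbhs0_lt.
apply: (@le_trans _ _ ((C + 1) * `|h|)); first by rewrite ler_wpM2r// lerDl.
rewrite mulrC -ler_pdivlMr ?ltr_wpDl//.
by near: h; apply: dnbhs0_le; rewrite divr_gt0// ltr_wpDl.
Unshelve. all: by end_near. Qed.

Lemma unitmx_of_ker p (A : 'M[R]_p) :
  (forall x : 'cV[R]_p, A *m x = 0 -> x = 0) -> A \in unitmx.
Proof.
move=> kerA; rewrite -unitmx_tr -row_free_unit -kermx_eq0; apply/eqP/row_matrixP => i.
rewrite row0; apply: (can_inj (@trmxK _ _ _)); rewrite trmx0; apply: kerA.
apply: (can_inj (@trmxK _ _ _)); rewrite trmx_mul trmxK trmx0.
exact/sub_kermxP/row_sub.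
Qed.

Variables (N : nat) (r : 'I_N -> R) (Sd : R) (m : 'I_N -> R).
Variables (n : nat) (z : 'I_n -> 'I_N) (Dec : 'I_n -> {set 'I_N}).
Hypothesis Dec_self : forall k, z k \notin Dec k.
Variables (gain : 'I_N -> R) (epsd : 'I_n -> R).
Variables (us : 'cV[R]_N) (ds : 'cV[R]_n).
Hypothesis equil : Qbar r z Dec ds *m us + Bbar r Sd m z Dec ds = 0.

(** [fastA] and [coupB] are the derivatives at [(us, ds)] of the averaged action drift in [u] and in
    [delta]; [slowH] is the derivative in [u] of the costs scaled by [epsd]. *)
Definition fastA : 'M[R]_N := - (diag_mx (\row_i gain i) *m Qbar r z Dec ds).

Definition coupB : 'M[R]_(N, n) := \matrix_(i, k)
  (gain i * (us i 0 - m i) * (if i \in Dec k then slope r i (z k) else 0)).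

Definition slowH : 'M[R]_(n, N) := \matrix_(k, j)
  (epsd k * (- (slope r (z k) j * (us (z k) 0 - m (z k))) -
             sales r Sd (z k) us * (j == z k)%:R)).

Lemma coupBE (d : 'cV[R]_n) i :
  (coupB *m d) i 0 = gain i * (us i 0 - m i) * tilt r z Dec i d.
Proof.
rewrite mxE /tilt mulr_sumr [in RHS]big_mkcond/=; apply: eq_bigr => k _.
by rewrite mxE; case: ifP => _; rewrite ?mulr0 ?mul0r//; ring.
Qed.

Lemma slowHE (w : 'cV[R]_N) k : (slowH *m w) k 0 = epsd k *
  (- (\sum_j slope r (z k) j * w j 0) * (us (z k) 0 - m (z k)) -
   sales r Sd (z k) us * w (z k) 0).
Proof.
transitivity (\sum_j (epsd k * (- (us (z k) 0 - m (z k))) * (slope r (z k) j * w j 0)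
    + epsd k * (- sales r Sd (z k) us) * ((j == z k)%:R * w j 0))).
  by rewrite mxE; apply: eq_bigr => j _; rewrite mxE; ring.
have -> : w (z k) 0 = \sum_j ((j == z k)%:R * w j 0).
  rewrite (bigD1 (z k))//= eqxx mul1r big1 ?addr0// => j /negbTE ->.
  by rewrite mul0r.
by rewrite big_split/= -!mulr_sumr; ring.
Qed.

(** Sales are affine and [tilt] is linear, so a bilinear term in [w] and [d] is the only one of
    second order; [equil] removes the constant. *)
Lemma drift_expand (w : 'cV[R]_N) (d : 'cV[R]_n) i :
  gain i * (sales r Sd i (us + w) +
    ((us + w) i 0 - m i) * (slope r i i + tilt r z Dec i (ds + d))) =
  (fastA *m w + coupB *m d) i 0 + gain i * w i 0 * tilt r z Dec i d.
Proof.
rewrite [(_ + coupB *m d) i 0]mxE coupBE.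
have -> : (fastA *m w) i 0 = gain i * (sales r Sd i (us + w) +
    ((us + w) i 0 - m i) * (slope r i i + tilt r z Dec i ds)).
  rewrite /fastA mulNmx -mulmxA mxE mul_diag_mx mxE mxE.
  have -> : Qbar r z Dec ds *m w = Qbar r z Dec ds *m (us + w) + Bbar r Sd m z Dec ds.
    by rewrite mulmxDr addrAC equil add0r.
  by rewrite pseudogradientE// mulrN opprK.
rewrite tiltD !mxE; ring.
Qed.

(** Subtracting [drift_expand] at [0] from [drift_expand] at [x] isolates the part linear in [x]. *)
Lemma Qbar_shift (x : 'cV[R]_N) (d : 'cV[R]_n) i :
  gain i * (Qbar r z Dec (ds + d) *m x) i 0 =
  - (fastA *m x) i 0 - gain i * x i 0 * tilt r z Dec i d.
Proof.
have := drift_expand x d i; have := drift_expand 0 d i.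
have := pseudogradientE r Sd m Dec_self i (us + x) (ds + d).
have := pseudogradientE r Sd m Dec_self i (us + 0) (ds + d).
rewrite !mulmxDr !mulmx0 !addr0 add0r (addrAC (_ *m us)).
rewrite [(_ + Qbar _ _ _ _ *m x) i 0]mxE [(fastA *m x + _) i 0]mxE.
rewrite [(0 : 'cV[R]_N) i 0]mxE mulr0 mul0r addr0 => -> /(canRL (addKr _)) ->.
by move=> h1 h2; rewrite mulrDr !mulrN h2 opprK h1; ring.
Qed.

Lemma ueq_equil d : Qbar r z Dec d \in unitmx ->
  Qbar r z Dec d *m ueq r Sd m z Dec d + Bbar r Sd m z Dec d = 0.
Proof. by move=> Qu; rewrite /ueq mulmxN mulKVmx// addNr. Qed.

Lemma fastA_Qbar_unit : fastA \in unitmx -> Qbar r z Dec ds \in unitmx.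
Proof.
by rewrite /fastA -mulNmx unitmx_mul => /andP[].
Qed.

Hypothesis Au : fastA \in unitmx.

(* [ueq (ds + h e)] solves a linear system perturbed at order [h]. *)
Lemma ueq_increment (e : 'cV[R]_n) :
  exists C d : R, [/\ 0 <= C, 0 < d & forall h : R, `|h| < d ->
    let E := ueq r Sd m z Dec (h *: e + ds) - us in
    enorm E <= C * `|h| /\
    enorm (E - h *: (- (invmx fastA *m coupB) *m e)) <= C * `|h| * `|h|].
Proof.
set Le := - (invmx fastA *m coupB) *m e.
pose Dg := diag_mx (\row_i (gain i * tilt r z Dec i e)).
pose M := invmx fastA *m Dg.
have [mu mu0 muM] := enorm_mulmx M.
have DgE (x : 'cV[R]_N) i : (Dg *m x) i 0 = gain i * x i 0 * tilt r z Dec i e.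
  by rewrite mul_diag_mx !mxE; ring.
have L0 := enorm_ge0 Le.
exists (2 * enorm Le + mu * (2 * enorm Le)), (2 * mu)^-1.
split=> [||h hd E].
- by rewrite addr_ge0// ?mulr_ge0// ltW.
- by rewrite invr_gt0 mulr_gt0.
have hmu : `|h| * mu <= 1 / 2.
  by have := ltW hd; rewrite -[(2 * mu)^-1]mul1r ler_pdivlMr ?mulr_gt0//; lra.
rewrite {}/E (addrC (h *: e)).
(* As [|h| * mu <= 1 / 2], a solution of this fixed point equation has at most twice the size of
   [y]. Taking [y = 0] gives the invertibility of [Qbar], and [y = h *: Le] the expansion of
   [ueq]. *)
have small (x y : 'cV[R]_N) : x = y - h *: (M *m x) ->
    enorm x <= 2 * enorm y /\ enorm (x - y) <= `|h| * (mu * enorm x).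
  move=> xE; have hM : enorm (h *: (M *m x)) <= `|h| * (mu * enorm x).
    by rewrite enormZ ler_wpM2l.
  split; last by rewrite {1}xE addrAC subrr add0r enormN.
  have := enormD y (- (h *: (M *m x))); rewrite -xE enormN.
  by have := ler_wpM2r (enorm_ge0 x) hmu; lra.
have Qu : Qbar r z Dec (ds + h *: e) \in unitmx.
  apply: unitmx_of_ker => x Qx.
  have Ax : fastA *m x = - (h *: (Dg *m x)).
    apply/matrixP => i j; rewrite (ord1 j) {j}.
    have := Qbar_shift x (h *: e) i; rewrite Qx mxE mulr0 tiltZ => /eqP.
    rewrite eq_sym subr_eq0 => /eqP/(congr1 -%R); rewrite opprK => ->.
    by rewrite [RHS]mxE [(h *: (Dg *m x)) i 0]mxE DgE; ring.
  have /small[x0 _] : x = 0 - h *: (M *m x).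
    by rewrite sub0r /M -mulmxA scalemxAr -mulmxN -Ax mulKmx.
  by apply: enorm_eq0; apply/le_anti; rewrite enorm_ge0 (le_trans x0)// enorm0 mulr0.
set E := ueq _ _ _ _ _ _ - us.
have EE : E = h *: Le - h *: (M *m E).
  have : fastA *m E = - (coupB *m (h *: e)) - h *: (Dg *m E).
    apply/matrixP => i j; rewrite (ord1 j) {j}.
    have usE : us + E = ueq r Sd m z Dec (ds + h *: e) by rewrite addrC subrK.
    have := pseudogradientE r Sd m Dec_self i (us + E) (ds + h *: e).
    rewrite {1}usE ueq_equil// [LHS]mxE => /eqP; rewrite eq_sym oppr_eq0 => /eqP pg.
    have := drift_expand E (h *: e) i; rewrite pg.
    rewrite mulr0 mxE tiltZ => h0.
    rewrite [RHS]mxE [(- (coupB *m (h *: e))) i 0]mxE.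
    rewrite [(- (h *: (Dg *m E))) i 0]mxE [(h *: (Dg *m E)) i 0]mxE DgE; lra.
  move=> /(congr1 (mulmx (invmx fastA))); rewrite mulKmx// => EE; rewrite {1}EE.
  rewrite mulmxBr; congr (_ - _); last by rewrite -scalemxAr /M -mulmxA.
  by rewrite /Le mulNmx mulmxN -!scalemxAr scalerN mulmxA.
have [E1 E2] := small _ _ EE; rewrite enormZ in E1.
split.
  apply: (le_trans E1).
  have -> : 2 * (`|h| * enorm Le) = 2 * enorm Le * `|h| by ring.
  rewrite ler_wpM2r// lerDl.
  by rewrite !mulr_ge0// ltW.
apply: (le_trans E2); rewrite [leRHS]mulrC ler_wpM2l//.
apply: (@le_trans _ _ (mu * (2 * (`|h| * enorm Le)))); first by rewrite ler_pM2l.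
have -> : mu * (2 * (`|h| * enorm Le)) = mu * (2 * enorm Le) * `|h| by ring.
by rewrite ler_wpM2r// lerDr mulr_ge0.
Qed.

(** Chain rule: [ueq] has derivative [- A^-1 B], and [slowH] differentiates the scaled costs. The
    transpose appears because the rows of [Lambda] are indexed by the variable of
    differentiation. *)
Lemma LambdaE : us = ueq r Sd m z Dec ds ->
  (Lambda r Sd m z Dec epsd ds)^T = slowH *m - (invmx fastA *m coupB).
Proof.
move=> usE; apply/matrixP => k j; rewrite !mxE.
pose e : 'cV[R]_n := delta_mx j 0.
have -> : \sum_i slowH k i * (- (invmx fastA *m coupB)) i j =
    (slowH *m (- (invmx fastA *m coupB) *m e)) k 0.
  by rewrite mulmxA -colE [RHS]mxE [RHS]mxE.
set Le := _ *m e.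
have [C [d [C0 d0 inc]]] := ueq_increment e.
have [cH cH0 cHP] := enorm_mulmx slowH.
pose sl := \row_i slope r (z k) i.
have [cs cs0 csP] := enorm_mulmx sl.
apply: (@deriveE_linear_error _ _ _ _ _ (cH * C + `|epsd k| * (cs * C * C)) d) => //.
  by rewrite addr_ge0// !mulr_ge0// ltW.
move=> h h0 hd; have [] := inc h hd.
set E := ueq _ _ _ _ _ _ - us => E1 E2.
have -> : xi r Sd m z Dec epsd k (h *: e + ds) - xi r Sd m z Dec epsd k ds =
    (slowH *m E) k 0 - epsd k * ((\sum_i slope r (z k) i * E i 0) * E (z k) 0).
  rewrite /xi -usE -(subrK us (ueq _ _ _ _ _ (h *: e + ds))) -/E (addrC E) JD slowHE.
  by ring.
clearbody E.
have -> : (slowH *m Le) k 0 = h^-1 * (slowH *m (h *: Le)) k 0.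
  by rewrite -scalemxAr [(h *: (slowH *m Le)) k 0]mxE mulrA mulVf// mul1r.
rewrite -mulrBr addrAC.
have -> : (slowH *m E) k 0 - (slowH *m (h *: Le)) k 0 = (slowH *m (E - h *: Le)) k 0.
  have subE (u v : 'cV[R]_n) : u k 0 - v k 0 = (u - v) k 0 by rewrite !mxE.
  by rewrite (mulmxBr slowH E) subE.
rewrite normrM normfV mulrC ler_pdivrMr ?normr_gt0//.
apply: (le_trans (ler_normB _ _)); rewrite !mulrDl lerD//.
  apply: (le_trans (coord_le_enorm _ _)); apply: (le_trans (cHP _)).
  by rewrite -!mulrA ler_pM2l// mulrA.
rewrite !normrM -!mulrA ler_wpM2l//.
have -> : cs * (C * (C * (`|h| * `|h|))) = (cs * (C * `|h|)) * (C * `|h|) by ring.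
apply: ler_pM => //; last exact: le_trans (coord_le_enorm _ _) E1.
have -> : \sum_i slope r (z k) i * E i 0 = (sl *m E) 0 0.
  by rewrite [RHS]mxE; apply: eq_bigr => i _; rewrite mxE.
apply: (le_trans (coord_le_enorm _ _)); apply: (le_trans (csP _)).
by rewrite ler_pM2l.
Qed.

End Linearization.

(** * Bounded Lipschitz vector fields *)

Section Coordinates.
Variables (R : realType) (p : nat).
Implicit Types zeta : R -> 'cV[R]_p.

Lemma is_derive_cV zeta (dz : 'cV[R]_p) (t : R) :
  is_derive t 1 zeta dz <-> forall i, is_derive t 1 (fun t => zeta t i 0) (dz i 0).
Proof.
split=> [[dzeta dzE] i|coord].
  apply: DeriveDef; first by move/derivable_mxP : dzeta; exact.
  by rewrite -dzE derive_mx// mxE.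
have dzeta : derivable zeta t 1.
  by apply/derivable_mxP => i j; rewrite (ord1 j); case: (coord i).
apply: DeriveDef => //; rewrite derive_mx//; apply/matrixP => i j.
by rewrite mxE (ord1 j); case: (coord i).
Qed.

Lemma continuous_cV zeta :
  (forall i, continuous (fun t => zeta t i 0)) -> continuous zeta.
Proof.
move=> cz t; apply/cvgrPdist_le => e e0; near=> u.
rewrite /Num.Def.normr/= mx_normrE (bigmax_le _ (ltW e0))//= => -[i j] _.
rewrite !mxE/= (ord1 j) {j}; move: i; near: u; apply: filter_forall => i.
by move/cvgrPdist_le : (cz i t); exact.
Unshelve. all: by end_near. Qed.

(** A solution is continuous only within the half-line, whereas [practical_stability] wants
    continuity everywhere; freezing the curve before time [0] reconciles the two. *)
Lemma continuous_max0 zeta : {within `[0, +oo[%classic, continuous zeta} ->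
  forall i, continuous (fun t : R => zeta (Num.max t 0) i 0).
Proof.
move=> cz i t.
have A0 : `[0, +oo[%classic (Num.max t 0) by rewrite /= in_itv/= andbT le_max lexx orbT.
have := cz (Num.max t 0); rewrite /continuous_at /=.
move=> /cvgrPdist_le cz'; apply/cvgrPdist_le => e e0.
have zn : within `[0, +oo[%classic (nbhs (Num.max t 0))
    [set u | `|zeta (Num.max t 0) - zeta u| <= e].
  by rewrite (nbhs_subspace_in A0); exact: cz'.
have cm : continuous (fun t : R => Num.max t 0 : R).
  by move=> u; apply: continuous_max; [exact: cvg_id|exact: cst_continuous].
have zu0 : \forall u \near t, `[0, +oo[%classic (Num.max u 0) ->
    `|zeta (Num.max t 0) - zeta (Num.max u 0)| <= e by exact: (cm t _ zn).
near=> u; have zu : `[0, +oo[%classic (Num.max u 0) ->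
    `|zeta (Num.max t 0) - zeta (Num.max u 0)| <= e by near: u.
have A1 : `[0, +oo[%classic (Num.max u 0) by rewrite /= in_itv/= andbT le_max lexx orbT.
apply: le_trans (zu A1).
rewrite [leRHS]/Num.Def.normr/= mx_normrE.
apply: le_trans (le_bigmax _ _ (i, 0)) => /=.
by rewrite !mxE.
Unshelve. all: by end_near. Qed.

End Coordinates.

Section Regular.
Variables (R : realType) (p : nat).
Implicit Types g h : R -> R -> 'cV[R]_p -> R.

(** These are the hypotheses of [picard], uniformly in [om]. Boundedness is kept together with the
    Lipschitz property so that products stay regular. *)
Definition regular g : Prop := exists K : R,
  [/\ forall om t x, `|g om t x| <= K,
      forall om t (x y : 'cV[R]_p) d, 0 <= d -> (forall j, `|x j 0 - y j 0| <= d) ->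
        `|g om t x - g om t y| <= K * d &
      forall om (x : R -> 'cV[R]_p), (forall i, continuous (fun t => x t i 0)) ->
        continuous (fun t => g om t (x t))].

Lemma reg_cst (c : R) : regular (fun _ _ _ => c).
Proof.
exists `|c|; split=> // [om t x y d d0 _|om x _]; last exact: cont_cst.
by rewrite subrr normr0 mulr_ge0.
Qed.

Lemma reg_add g h : regular g -> regular h ->
  regular (fun om t x => g om t x + h om t x).
Proof.
move=> [K [gK gL gC]] [L [hK hL hC]]; exists (K + L); split.
- by move=> om t x; rewrite (le_trans (ler_normD _ _))// lerD.
- move=> om t x y d d0 xy.
  have -> : g om t x + h om t x - (g om t y + h om t y) =
    (g om t x - g om t y) + (h om t x - h om t y) by ring.
  by rewrite (le_trans (ler_normD _ _))// mulrDl lerD ?gL ?hL.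
- by move=> om x cx; apply: cont_add; [exact: gC|exact: hC].
Qed.

Lemma reg_mul g h : regular g -> regular h ->
  regular (fun om t x => g om t x * h om t x).
Proof.
move=> [K [gK gL gC]] [L [hK hL hC]].
have K0 : 0 <= K by exact: le_trans (gK 0 0 0).
have L0 : 0 <= L by exact: le_trans (hK 0 0 0).
exists (K * L + K * L); split.
- move=> om t x; rewrite normrM (@le_trans _ _ (K * L)) ?ler_pM//.
  by rewrite lerDl mulr_ge0.
- move=> om t x y d d0 xy.
  have -> : g om t x * h om t x - g om t y * h om t y =
    (g om t x - g om t y) * h om t x + g om t y * (h om t x - h om t y) by ring.
  rewrite (le_trans (ler_normD _ _))// !normrM mulrDl lerD//.
    by rewrite -mulrA (mulrC L) mulrA ler_pM// gL.
  by rewrite -mulrA ler_pM// hL.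
- by move=> om x cx; apply: cont_mul; [exact: gC|exact: hC].
Qed.

Lemma reg_opp g : regular g -> regular (fun om t x => - g om t x).
Proof.
move=> [K [gK gL gC]]; exists K; split.
- by move=> om t x; rewrite normrN.
- by move=> om t x y d d0 xy; rewrite -opprD normrN gL.
- by move=> om x cx t; apply: continuousN; exact: gC.
Qed.

Lemma reg_sum (I : finType) (P : pred I) (g : I -> R -> R -> 'cV[R]_p -> R) :
  (forall i, regular (g i)) -> regular (fun om t x => \sum_(i | P i) g i om t x).
Proof.
move=> rg; elim: (index_enum I) => [|i s IH].
  suff -> : (fun om t x => \sum_(i <- [::] | P i) g i om t x) = (fun _ _ _ => 0).
    exact: reg_cst.
  by do 3 apply/funext => ?; rewrite big_nil.
have [Pi|nPi] := boolP (P i).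
  suff -> : (fun om t x => \sum_(i <- i :: s | P i) g i om t x) =
      (fun om t x => g i om t x + \sum_(i <- s | P i) g i om t x).
    exact: reg_add.
  by do 3 apply/funext => ?; rewrite big_cons Pi.
suff -> : (fun om t x => \sum_(i <- i :: s | P i) g i om t x) =
    (fun om t x => \sum_(i <- s | P i) g i om t x) by [].
by do 3 apply/funext => ?; rewrite big_cons (negbTE nPi).
Qed.

Lemma reg_sin (nu : R) : regular (fun om t _ => sin (om * nu * t)).
Proof.
exists 1; split.
- by move=> om t _; rewrite ler_norml sin_geN1 sin_le1.
- by move=> om t x y d d0 _; rewrite subrr normr0 mul1r.
- move=> om _ _; apply: cont_comp; last exact: continuous_sin.
  by apply: cont_mul; [exact: cont_cst|exact: cont_id].
Qed.

Lemma clamp_lip (lo hi u v d : R) : `|u - v| <= d ->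
  `|Num.max lo (Num.min hi u) - Num.max lo (Num.min hi v)| <= d.
Proof.
rewrite !ler_norml /Num.max /Num.min => /andP[h1 h2].
by case: (ltP hi u) => ?; case: (ltP hi v) => ?; case: (ltP lo hi) => ?;
  case: (ltP lo u) => ?; case: (ltP lo v) => ?; apply/andP; split; lra.
Qed.

Variables (c : 'cV[R]_p) (rho : R).
Hypothesis rho_ge0 : 0 <= rho.

(** A cube, because truncation coordinate by coordinate is visibly Lipschitz; it contains the
    Euclidean ball of radius [rho], as [clip_id] requires. *)
Definition clip (x : 'cV[R]_p) : 'cV[R]_p :=
  \col_i Num.max (c i 0 - rho) (Num.min (c i 0 + rho) (x i 0)).

Lemma clip_id x : enorm (x - c) <= rho -> clip x = x.
Proof.
move=> xc; apply/matrixP => i j; rewrite (ord1 j) mxE.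
have := le_trans (coord_le_enorm (x - c) i) xc; rewrite !mxE ler_norml => /andP[h1 h2].
rewrite min_r ?max_r//; lra.
Qed.

Lemma reg_clip i : regular (fun _ _ x => clip x i 0).
Proof.
exists (`|c i 0| + rho + 1); split.
- move=> _ _ x; rewrite mxE.
  apply: (@le_trans _ _ (`|c i 0| + rho)); last by rewrite lerDl.
  have := ler_norm (c i 0); have := ler_norm (- c i 0); rewrite normrN => h1 h2.
  have : c i 0 - rho <= Num.max (c i 0 - rho) (Num.min (c i 0 + rho) (x i 0)).
    by rewrite le_max lexx.
  have : Num.max (c i 0 - rho) (Num.min (c i 0 + rho) (x i 0)) <= c i 0 + rho.
    by rewrite ge_max ge_min lexx andbT; have := rho_ge0; lra.
  by rewrite ler_norml; lra.
- move=> _ _ x y d d0 xy; rewrite !mxE.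
  apply: (@le_trans _ _ d); last by rewrite ler_peMl// lerDr addr_ge0.
  exact: clamp_lip.
- move=> _ x cx; under eq_fun do rewrite mxE.
  move=> t; apply: (@continuous_max R R (fun=> c i 0 - rho)
    (fun t => Num.min (c i 0 + rho) (x t i 0))); first exact: cst_continuous.
  apply: (@continuous_min R R (fun=> c i 0 + rho) (fun t => x t i 0)).
    exact: cst_continuous.
  exact: cx.
Qed.

End Regular.

(** * The oscillating dynamics and its mean *)

Section Dynamics.
Variables (R : realType) (N : nat) (r : 'I_N -> R) (Sd : R) (m : 'I_N -> R).
Variables (n : nat) (z : 'I_n -> 'I_N) (Dec : 'I_n -> {set 'I_N}).
Hypothesis Dec_self : forall k, z k \notin Dec k.
Variables (gain : 'I_N -> R) (epsd : 'I_n -> R).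
Variables (omb : 'I_N -> rat).
Hypotheses (omb_gt0 : forall i, 0 < omb i) (omb_inj : injective omb).
Variables (Jref : 'cV[R]_n) (eps : R) (a : 'I_N -> R).
Hypothesis a_gt0 : forall i, 0 < a i.

Local Notation probe := (probe omb).
Local Notation dyn := (dyn r Sd m z Dec gain epsd Jref omb eps a).

(** The weight of probe [l] in the action of player [j]: its own probe, plus those it injects in
    order to deceive. *)
Definition chi (d : 'cV[R]_n) (j l : 'I_N) : R :=
  (j == l)%:R + \sum_(k | (z k == j) && (l \in Dec k)) d k 0.

Lemma actionE om t u d j : action z Dec omb a om t u d j 0 =
  u j 0 + \sum_l a l * chi d j l * probe om l t.
Proof.
rewrite mxE -addrA; congr (_ + _).
have -> : \sum_l a l * chi d j l * probe om l t =
    \sum_l (j == l)%:R * (a l * probe om l t) +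
    \sum_l \sum_(k | (z k == j) && (l \in Dec k)) d k 0 * (a l * probe om l t).
  rewrite -big_split; apply: eq_bigr => l _ /=.
  by rewrite /chi mulrDr mulrDl -mulr_suml; ring.
congr (_ + _).
  rewrite (bigD1 j)//= eqxx mul1r big1 ?addr0// => l.
  by rewrite eq_sym => /negbTE ->; rewrite mul0r.
under eq_bigr do rewrite mulr_sumr big_mkcond/=.
rewrite [RHS](eq_bigr (fun l => \sum_(k | z k == j)
    if l \in Dec k then d k 0 * (a l * probe om l t) else 0)); last first.
  by move=> l _; rewrite big_mkcondr.
by rewrite exchange_big.
Qed.

Lemma sales_actionE om t i u d : sales r Sd i (action z Dec omb a om t u d) =
  sales r Sd i u + \sum_l (a l * \sum_j slope r i j * chi d j l) * probe om l t.
Proof.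
set y := action _ _ _ _ _ _ _ _.
rewrite -(subrKC u y) salesD; congr (_ + _).
have -> : \sum_l (a l * \sum_j slope r i j * chi d j l) * probe om l t =
    \sum_l \sum_j slope r i j * (a l * chi d j l * probe om l t).
  apply: eq_bigr => l _; rewrite mulr_sumr mulr_suml.
  by apply: eq_bigr => j _; ring.
rewrite exchange_big; apply: eq_bigr => j _ /=; rewrite -mulr_sumr.
have subE (v w : 'cV[R]_N) : (v - w) j 0 = v j 0 - w j 0 by rewrite !mxE.
by rewrite subE /y actionE addrAC subrr add0r.
Qed.

Lemma chi_self d i : chi d i i = 1.
Proof.
rewrite /chi eqxx big1 ?addr0// => k /andP[/eqP zk ik].
by move: (Dec_self k); rewrite zk ik.
Qed.

(** The mechanism of deception: the deceivers of [i] inject the probe of [i] into their own actions,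
    which shifts the slope that [i] reads through this probe. *)
Lemma slope_chi d i : \sum_j slope r i j * chi d j i = slope r i i + tilt r z Dec i d.
Proof.
under eq_bigr do rewrite /chi mulrDr.
rewrite big_split/=; congr (_ + _).
  rewrite (bigD1 i)//= eqxx mulr1 big1 ?addr0// => j /negbTE ->.
  by rewrite mulr0.
rewrite /tilt (eq_bigr (fun j => \sum_(k | z k == j)
    if i \in Dec k then d k 0 * slope r i (z k) else 0)); last first.
  move=> j _; rewrite mulr_sumr big_mkcondr; apply: eq_bigr => k /eqP ->.
  by case: ifP => // _; rewrite mulrC.
rewrite [RHS]big_mkcond/= (exchange_big_dep xpredT)//=.
by apply: eq_bigr => k _; rewrite (big_pred1 (z k)).
Qed.

Lemma dyn_lshift om t zeta i : dyn om t zeta (lshift n i) 0 =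
  2 * gain i / a i *
  (sales r Sd i (action z Dec omb a om t (usubmx zeta) (dsubmx zeta)) *
   (action z Dec omb a om t (usubmx zeta) (dsubmx zeta) i 0 - m i) * probe om i t).
Proof. by rewrite col_mxEu mxE /J; ring. Qed.

Lemma dyn_rshift om t zeta k : dyn om t zeta (rshift N k) 0 =
  eps * epsd k *
  (- (sales r Sd (z k) (action z Dec omb a om t (usubmx zeta) (dsubmx zeta)) *
   (action z Dec omb a om t (usubmx zeta) (dsubmx zeta) (z k) 0 - m (z k))) - Jref k 0).
Proof. by rewrite col_mxEd mxE /J mulNr. Qed.

(** The sum with factor [2^-1] is the bias left in the costs by the squares of the probes. *)
Definition mean (zeta : 'cV[R]_(N + n)) : 'cV[R]_(N + n) :=
  let u := usubmx zeta in let d := dsubmx zeta in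
  col_mx
    (\col_i (gain i * (sales r Sd i u +
                       (u i 0 - m i) * (slope r i i + tilt r z Dec i d))))
    (\col_k (eps * epsd k * (J r Sd m (z k) u - Jref k 0 -
       2^-1 * \sum_l (a l * \sum_j slope r (z k) j * chi d j l) * (a l * chi d (z k) l)))).

Lemma dyn_regular (c : 'cV[R]_(N + n)) (rho : R) : 0 <= rho ->
  forall i, regular (fun om t x => dyn om t (clip c rho x) i 0).
Proof.
move=> rho0.
have reg_probe i : regular (fun om t (_ : 'cV[R]_(N + n)) => probe om i t).
  exact: reg_sin.
have reg_act j : regular (fun om t (x : 'cV[R]_(N + n)) => action z Dec omb a om t
    (usubmx (clip c rho x)) (dsubmx (clip c rho x)) j 0).
  suff -> : (fun om t x => action z Dec omb a om t (usubmx (clip c rho x))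
      (dsubmx (clip c rho x)) j 0) =
    (fun om t x => clip c rho x (lshift n j) 0 + a j * probe om j t +
      \sum_(k | z k == j) clip c rho x (rshift N k) 0 *
        \sum_(l in Dec k) a l * probe om l t).
    apply: reg_add.
      by apply: reg_add; [exact: reg_clip|apply: reg_mul; [exact: reg_cst|]].
    apply: reg_sum => k; apply: reg_mul; first exact: reg_clip.
    by apply: reg_sum => l; apply: reg_mul; [exact: reg_cst|].
  do 3 apply/funext => ?; rewrite mxE [usubmx _ _ _]mxE; congr (_ + _).
  by apply: eq_bigr => k _; rewrite [dsubmx _ _ _]mxE.
have reg_sales i : regular (fun om t (x : 'cV[R]_(N + n)) => sales r Sd i (action z Dec omb a om t
    (usubmx (clip c rho x)) (dsubmx (clip c rho x)))).
  suff -> : (fun om t x => sales r Sd i (action z Dec omb a om t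
      (usubmx (clip c rho x)) (dsubmx (clip c rho x)))) =
    (fun om t x => Rpar r / r i * Sd + \sum_j slope r i j *
       action z Dec omb a om t (usubmx (clip c rho x)) (dsubmx (clip c rho x)) j 0).
    apply: reg_add; first exact: reg_cst.
    by apply: reg_sum => j; apply: reg_mul; [exact: reg_cst|exact: reg_act].
  by do 3 apply/funext => ?; rewrite salesE.
move=> i; case: (split_ordP i) => [j ->|k ->].
  suff -> : (fun om t x => dyn om t (clip c rho x) (lshift n j) 0) = (fun om t x =>
      2 * gain j / a j * (sales r Sd j (action z Dec omb a om t (usubmx (clip c rho x))
        (dsubmx (clip c rho x))) * (action z Dec omb a om t (usubmx (clip c rho x))
        (dsubmx (clip c rho x)) j 0 + - m j) * probe om j t)).
    apply: reg_mul; first exact: reg_cst.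
    apply: reg_mul => //; apply: reg_mul => //.
    by apply: reg_add => //; exact: reg_cst.
  by do 3 apply/funext => ?; rewrite dyn_lshift.
suff -> : (fun om t x => dyn om t (clip c rho x) (rshift N k) 0) = (fun om t x =>
    eps * epsd k * (- (sales r Sd (z k) (action z Dec omb a om t (usubmx (clip c rho x))
      (dsubmx (clip c rho x))) * (action z Dec omb a om t (usubmx (clip c rho x))
      (dsubmx (clip c rho x)) (z k) 0 + - m (z k))) + - Jref k 0)).
  apply: reg_mul; first exact: reg_cst.
  apply: reg_add; last exact: reg_cst.
  apply: reg_opp; apply: reg_mul => //.
  by apply: reg_add => //; exact: reg_cst.
by do 3 apply/funext => ?; rewrite dyn_rshift.
Qed.

(* A point of [Th] is a frequency together with a trajectory; [Dom] singles
   out the times at which this trajectory solves the dynamics inside the ball. *)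
Definition Th : Type := {posnum R} * (R -> 'cV[R]_(N + n)).
Definition freq (th : Th) : R := th.1%:num.
Definition Dom (c : 'cV[R]_(N + n)) (rho : R) (th : Th) (t : R) : Prop :=
  enorm (th.2 t - c) <= rho /\
  forall i, is_derive t 1 (fun t => th.2 t i 0) (dyn (freq th) t (th.2 t) i 0).

(** In the ball the field equals its clipped version, whose bound is uniform in frequency, time and
    state. *)
Lemma slow_state c rho i : 0 <= rho -> slow (Dom c rho) (fun th t => th.2 t i 0).
Proof.
move=> rho0; have [K [dK _ _]] := dyn_regular c rho0 i.
exists (fun th t => dyn (freq th) t (th.2 t) i 0), (`|c i 0| + rho + K) => th t [ball dz].
have K0 : 0 <= K by exact: le_trans (dK 0 0 0).
split; last exact: dz.
- apply: (@le_trans _ _ (`|c i 0| + rho)); last by rewrite lerDl.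
  have := le_trans (coord_le_enorm _ i) ball; rewrite !mxE => h.
  have -> : th.2 t i 0 = c i 0 + (th.2 t i 0 - c i 0) by rewrite addrC subrK.
  by rewrite (le_trans (ler_normD _ _))// lerD2l.
- rewrite -(clip_id ball); apply: (le_trans (dK _ _ _)).
  by rewrite lerDr addr_ge0.
Qed.

Lemma dyn_averages c rho i : 0 <= rho ->
  averages (Dom c rho) freq (fun th t => dyn (freq th) t (th.2 t) i 0)
    (fun th t => mean (th.2 t) i 0).
Proof.
move=> rho0.
have f0 th : 0 < freq th by rewrite /freq.
have nu0 j : 0 < ratr (omb j) :> R by rewrite ltr0q.
have nu_inj : injective (fun j => ratr (omb j) : R).
  by move=> j k /= /(fmorph_inj (ratr : {rmorphism rat -> R})) /omb_inj.
have st j : slow (Dom c rho) (fun th t => th.2 t j 0) by exact: slow_state.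
have kst k := slow_cst (Dom c rho) k.
have schi j l : slow (Dom c rho) (fun th t => chi (dsubmx (th.2 t)) j l).
  apply: slow_add; first exact: kst.
  suff -> : (fun th t => \sum_(k | (z k == j) && (l \in Dec k)) dsubmx (th.2 t) k 0) =
    (fun th t => \sum_(k | (z k == j) && (l \in Dec k)) (th : Th).2 t (rshift N k) 0).
    exact: slow_sum.
  by do 2 apply/funext => ?; apply: eq_bigr => k _; rewrite mxE.
have su j : slow (Dom c rho) (fun th t => usubmx (th.2 t) j 0).
  suff -> : (fun th t => usubmx (th.2 t) j 0) = (fun th t => (th : Th).2 t (lshift n j) 0) by [].
  by do 2 apply/funext => ?; rewrite mxE.
have ssales j : slow (Dom c rho) (fun th t => sales r Sd j (usubmx (th.2 t))).
  suff -> : (fun th t => sales r Sd j (usubmx (th.2 t))) =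
    (fun th t => Rpar r / r j * Sd + \sum_k slope r j k * usubmx ((th : Th).2 t) k 0).
    apply: slow_add; first exact: kst.
    by apply: slow_sum => k; apply: slow_mul.
  by do 2 apply/funext => ?; rewrite salesE.
have su' j : slow (Dom c rho) (fun th t => usubmx (th.2 t) j 0 - m j).
  by apply: (slow_add (f := fun _ _ => - m j)).
have sbe j l : slow (Dom c rho)
    (fun th t => a l * \sum_k slope r j k * chi (dsubmx (th.2 t)) k l).
  by apply: slow_mul => //; apply: slow_sum => k; apply: slow_mul.
have set' j l : slow (Dom c rho) (fun th t => a l * chi (dsubmx (th.2 t)) j l).
  by apply: slow_mul.
have actm om t u d j : action z Dec omb a om t u d j 0 - m j =
   u j 0 - m j + \sum_l a l * chi d j l * probe om l t by rewrite actionE addrAC.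
case: (split_ordP i) => [j ->|k ->].
  have := avg_mul (kst (2 * gain j / a j))
    (avg_cubic f0 nu0 nu_inj (ssales j) (su' j) (sbe j) (set' j) j).
  apply: avg_ext => th t.
    by rewrite dyn_lshift sales_actionE actm.
  (* Both terms produced by [avg_cubic] carry a factor [a j], which cancels the division by
     [a j]. *)
  rewrite /mean col_mxEu [RHS]mxE slope_chi chi_self; field.
  by rewrite gt_eqF.
have := avg_mul (kst (eps * epsd k)) (avg_add (avg_mul (kst (-1))
  (avg_quad f0 nu0 nu_inj (ssales (z k)) (su' (z k)) (sbe (z k)) (set' (z k))))
  (avg_id _ _ (fun _ _ => - Jref k 0))).
apply: avg_ext => th t.
  by rewrite dyn_rshift sales_actionE actm mulN1r.
rewrite /mean col_mxEd [RHS]mxE /J; ring.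
Qed.

End Dynamics.

(** * Exact expansion of the averaged field at the equilibrium *)

Section Remainder.
Variables (R : realType) (N : nat) (r : 'I_N -> R) (Sd : R) (m : 'I_N -> R).
Variables (n : nat) (z : 'I_n -> 'I_N) (Dec : 'I_n -> {set 'I_N}).
Hypothesis Dec_self : forall k, z k \notin Dec k.
Variables (gain : 'I_N -> R) (epsd : 'I_n -> R) (Jref : 'cV[R]_n) (eps : R).
Variables (us : 'cV[R]_N) (ds : 'cV[R]_n).
Hypothesis equil : Qbar r z Dec ds *m us + Bbar r Sd m z Dec ds = 0.
Hypothesis attained : forall k, J r Sd m (z k) us = Jref k 0.

Definition quad_rem (x : 'cV[R]_(N + n)) : 'cV[R]_(N + n) :=
  let w := usubmx x in let d := dsubmx x in
  col_mx (\col_i (gain i * w i 0 * tilt r z Dec i d))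
         (\col_k (eps * epsd k * - ((\sum_j slope r (z k) j * w j 0) * w (z k) 0))).

Definition probe_rem (a : 'I_N -> R) (zeta : 'cV[R]_(N + n)) : 'cV[R]_(N + n) :=
  let d := dsubmx zeta in
  col_mx 0 (\col_k (eps * epsd k * - (2^-1 *
    \sum_l (a l * \sum_j slope r (z k) j * chi z Dec d j l) * (a l * chi z Dec d (z k) l)))).

Lemma mean_expand a zeta : let x := zeta - col_mx us ds in
  mean r Sd m z Dec gain epsd Jref eps a zeta =
  block_mx (fastA r z Dec gain ds) (coupB r m z Dec gain us)
    (eps *: slowH r Sd m z epsd us) 0 *m x + (quad_rem x + probe_rem a zeta).
Proof.
move=> x; have zE : zeta = x + col_mx us ds by rewrite subrK.
have uE : usubmx zeta = us + usubmx x by rewrite zE linearD/= col_mxKu addrC.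
have dE : dsubmx zeta = ds + dsubmx x by rewrite zE linearD/= col_mxKd addrC.
clearbody x; set Ae := block_mx _ _ _ _.
have -> : Ae *m x = col_mx
    (fastA r z Dec gain ds *m usubmx x + coupB r m z Dec gain us *m dsubmx x)
    (eps *: slowH r Sd m z epsd us *m usubmx x).
  by rewrite -{1}(vsubmxK x) mul_block_col mul0mx addr0.
rewrite !add_col_mx addr0.
rewrite /mean; congr col_mx; apply/matrixP => i j; rewrite (ord1 j) {j}.
  have addE (v w : 'cV[R]_N) : (v + w) i 0 = v i 0 + w i 0 by rewrite mxE.
  rewrite [LHS]mxE uE dE drift_expand// [RHS]addE.
  by congr (_ + _); rewrite [RHS]mxE.
rewrite [LHS]mxE uE JD attained.
have sH := slowHE r Sd m z epsd us (usubmx x) i.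
have addE (v w : 'cV[R]_n) : (v + w) i 0 = v i 0 + w i 0 by rewrite mxE.
have scE (k : R) (v : 'cV[R]_n) : (k *: v) i 0 = k * v i 0 by rewrite mxE.
have colE (f : 'I_n -> R) : (\col_k f k) i 0 = f i by rewrite mxE.
rewrite !addE -scalemxAl scE sH !colE dE.
by ring.
Qed.

Lemma enorm_col_mx_le p q (v : 'cV[R]_p) (w : 'cV[R]_q) :
  enorm (col_mx v w) <= \sum_i `|v i 0| + \sum_i `|w i 0|.
Proof.
apply: (le_trans (enorm_le_sum _)); rewrite big_split_ord/= lerD//.
  by apply: ler_sum => i _; rewrite col_mxEu.
by apply: ler_sum => i _; rewrite col_mxEd.
Qed.

Lemma quad_rem_bound : exists2 kap, 0 <= kap &
  forall x, enorm (quad_rem x) <= kap * enorm x ^+ 2.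
Proof.
exists (\sum_i `|gain i| * (\sum_(k | i \in Dec k) `|slope r i (z k)|) +
  \sum_k `|eps * epsd k| * (\sum_j `|slope r (z k) j|)) => [|x].
  rewrite addr_ge0// sumr_ge0// => i _; rewrite mulr_ge0// sumr_ge0//.
have X0 := enorm_ge0 x.
have wx j : `|usubmx x j 0| <= enorm x by rewrite mxE coord_le_enorm.
have dx k : `|dsubmx x k 0| <= enorm x by rewrite mxE coord_le_enorm.
apply: (le_trans (enorm_col_mx_le _ _)); rewrite mulrDl !mulr_suml.
apply: lerD; apply: ler_sum => i _; rewrite mxE.
  rewrite !normrM expr2 -!mulrA ler_wpM2l// mulrCA ler_pM//.
  apply: (le_trans (ler_norm_sum _ _ _)); rewrite mulr_suml; apply: ler_sum => k _.
  by rewrite normrM mulrC ler_wpM2l.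
rewrite normrM normrN (normrM (\sum_j _)) expr2 -mulrA ler_wpM2l// mulrA ler_pM//.
apply: (le_trans (ler_norm_sum _ _ _)); rewrite mulr_suml; apply: ler_sum => j _.
by rewrite normrM ler_wpM2l.
Qed.

(** The constant must precede [a]. The bias is quadratic in the amplitudes, and [amax <= 1] trades
    one of the two factors for [1]. *)
Lemma probe_rem_bound (rho : R) : 0 <= rho -> exists2 C, 0 <= C &
  forall (a : 'I_N -> R) (amax : R), (forall i, 0 < a i <= amax) -> 0 <= amax <= 1 ->
  forall zeta, enorm (zeta - col_mx us ds) <= rho -> enorm (probe_rem a zeta) <= C * amax.
Proof.
move=> rho0.
pose X := 1 + \sum_k (`|ds k 0| + rho).
have X0 : 0 <= X by rewrite addr_ge0// sumr_ge0// => k _; rewrite addr_ge0.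
exists (\sum_k `|eps * epsd k| * (2^-1 * \sum_(l < N) ((\sum_j `|slope r (z k) j| * X) * X))).
  rewrite sumr_ge0// => k _; rewrite !mulr_ge0// sumr_ge0// => l _; rewrite mulr_ge0//.
  by rewrite sumr_ge0// => j _; rewrite mulr_ge0.
move=> a amax aP /andP[amax0 amax1] zeta ball.
have chiX j l : `|chi z Dec (dsubmx zeta) j l| <= X.
  apply: (le_trans (ler_normD _ _)); apply: lerD.
    by case: (j == l); rewrite ?normr1 ?normr0.
  apply: (le_trans (ler_norm_sum _ _ _)); rewrite big_mkcond/=; apply: ler_sum => k _.
  case: ifP => _; last by rewrite addr_ge0.
  have := le_trans (coord_le_enorm _ (rshift N k)) ball.
  have -> : (zeta - col_mx us ds) (rshift N k) 0 = dsubmx zeta k 0 - ds k 0.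
    by rewrite -[ds in RHS](col_mxKd us) !mxE.
  move=> h; rewrite -{1}(subrK (ds k 0) (dsubmx zeta k 0)) addrC.
  by rewrite (le_trans (ler_normD _ _))// lerD2l.
apply: (le_trans (enorm_col_mx_le _ _)).
rewrite big1 ?add0r => [|i _]; last by rewrite mxE normr0.
rewrite mulr_suml; apply: ler_sum => k _; rewrite mxE normrM normrN -mulrA ler_wpM2l//.
rewrite normrM (ger0_norm (_ : 0 <= 2^-1))// -mulrA ler_wpM2l//.
apply: (le_trans (ler_norm_sum _ _ _)); rewrite [leRHS]mulr_suml; apply: ler_sum => l _.
have /andP[al0 alm] := aP l.
have ale : `|a l| <= amax by rewrite gtr0_norm.
have ale1 : `|a l| <= 1 by exact: le_trans amax1.
rewrite !normrM.
have sX : `|\sum_j slope r (z k) j * chi z Dec (dsubmx zeta) j l| <=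
    \sum_j `|slope r (z k) j| * X.
  apply: (le_trans (ler_norm_sum _ _ _)); apply: ler_sum => j _.
  by rewrite normrM ler_wpM2l.
set S := `|\sum_j _| in sX *; set S' := \sum_j _ in sX *.
have S0 : 0 <= S by exact: normr_ge0.
apply: (@le_trans _ _ ((1 * S') * (amax * X))); last by rewrite mul1r mulrCA mulrC.
by apply: ler_pM; rewrite ?mulr_ge0//; apply: ler_pM.
Qed.

End Remainder.

(** * Global solutions of the clipped dynamics *)

Section Existence.
Variables (R : realType) (N : nat) (N_gt0 : (0 < N)%N).
Variables (r : 'I_N -> R) (Sd : R) (m : 'I_N -> R).
Variables (n : nat) (z : 'I_n -> 'I_N) (Dec : 'I_n -> {set 'I_N}).
Variables (gain : 'I_N -> R) (epsd : 'I_n -> R).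
Variables (omb : 'I_N -> rat) (Jref : 'cV[R]_n) (eps : R) (a : 'I_N -> R).

Lemma clipped_solution (c z0 : 'cV[R]_(N + n)) (rho om : R) : 0 <= rho ->
  exists zeta : R -> 'cV[R]_(N + n),
  [/\ zeta 0 = z0, forall i, continuous (fun t => zeta t i 0) &
      forall t : R, 0 < t -> forall i, is_derive t 1 (fun t => zeta t i 0)
        (dyn r Sd m z Dec gain epsd Jref omb eps a om t (clip c rho (zeta t)) i 0)].
Proof.
move=> rho0.
have /choice[K KP] := dyn_regular r Sd m z Dec gain epsd omb Jref eps a c rho0.
pose K' := 1 + \sum_i `|K i|.
have K'0 : 0 < K' by rewrite ltr_wpDr// sumr_ge0.
have KK' i : K i <= K'.
  apply: (le_trans (ler_norm _)); rewrite ler_wpDl//.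
  exact: (term_le_sum (F := fun i => `|K i|)).
apply: (picard (f := fun t x =>
  dyn r Sd m z Dec gain epsd Jref omb eps a om t (clip c rho x)) z0 K'0).
- by move=> t x i; have [K1 _ _] := KP i; exact: le_trans (K1 _ _ _) (KK' i).
- move=> t x y d xy i; have [_ K2 _] := KP i.
  (* The sign of [d] is read off one coordinate, which exists because [0 < N]. *)
  have d0 : 0 <= d by exact: le_trans (xy (lshift n (Ordinal N_gt0))).
  by apply: (le_trans (K2 _ _ _ _ _ d0 xy)); rewrite ler_wpM2r.
- by move=> x cx i; have [_ _ K3] := KP i; exact: K3.
Qed.

End Existence.

Theorem theorem1 (R : realType) (N : nat) (N_ge2 : (2 <= N)%N)
    (r : 'I_N -> R) (r_gt0 : forall i, 0 < r i)
    (Sd : R) (m : 'I_N -> R)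
    (n : nat) (z : 'I_n -> 'I_N) (z_inj : injective z)
    (Dec : 'I_n -> {set 'I_N})
    (Dec_neq0 : forall k, Dec k != finset.set0)
    (Dec_self : forall k, z k \notin Dec k)
    (gain : 'I_N -> R) (gain_gt0 : forall i, 0 < gain i)
    (epsd : 'I_n -> R) (epsd_gt0 : forall k, 0 < epsd k)
    (omb : 'I_N -> rat) (omb_gt0 : forall i, 0 < omb i)
    (omb_inj : injective omb)
    (Jref : 'cV[R]_n)
    (Jref_att : Jref \in Omega r Sd m z Dec gain epsd) :
  exists (ustar : 'cV[R]_N) (dstar : 'cV[R]_n),
    [/\ attains r Sd m z Dec gain epsd dstar Jref,
        ustar = ueq r Sd m z Dec dstar
      & let zstar := col_mx ustar dstar in
        exists2 epsstar : R, 0 < epsstar &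
        forall eps : R, 0 < eps < epsstar ->
        exists astar C M lam rho : R,
          [/\ 0 < astar, 0 < C, 0 < M, 0 < lam & 0 < rho] /\
        forall a : 'I_N -> R, (forall i, 0 < a i < astar) ->
        exists2 omstar : R, 0 < omstar &
        forall om : R, omstar < om ->
        forall zeta0 : 'cV[R]_(N + n), enorm (zeta0 - zstar) < rho ->
          (exists2 zeta : R -> 'cV[R]_(N + n),
             solution r Sd m z Dec gain epsd Jref omb eps a om zeta &
             zeta 0 = zeta0) /\
          forall zeta : R -> 'cV[R]_(N + n),
            solution r Sd m z Dec gain epsd Jref omb eps a om zeta ->
            zeta 0 = zeta0 ->
            forall t : R, 0 <= t ->
              enorm (zeta t - zstar) <=
                M * expR (- lam * t) * enorm (zeta0 - zstar) +
                C * (om^-1 + \big[Num.max/0]_i a i)].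
Proof.
move: Jref_att; rewrite inE => -[ds att]; have [dsD JE LH] := att.
pose us := ueq r Sd m z Dec ds; exists us, ds; split=> // zs.
pose A := fastA r z Dec gain ds; pose B := coupB r m z Dec gain us.
pose H := slowH r Sd m z epsd us.
have hA : hurwitz A by move: dsD; rewrite inE.
have Au : A \in unitmx := hurwitz_unit hA.
have equil : Qbar r z Dec ds *m us + Bbar r Sd m z Dec ds = 0.
  exact: ueq_equil (fastA_Qbar_unit Au).
have lS : lyapunov (H *m - (invmx A *m B)).
  by rewrite -(LambdaE Dec_self epsd equil Au erefl); exact/hurwitz_lyapunov/hurwitz_trmx.
have [e e0 eP] := singular_perturbation Au (hurwitz_lyapunov hA) lS.
exists e => // eps /eP lyap; pose Ae := block_mx A B (eps *: H) 0.
have [kap kap0 kapP] := quad_rem_bound r z Dec gain epsd eps.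
have [rho [M [lam [C [[rho0 M1 lam0 C0] stab]]]]] := practical_stability lyap kap0.
have [Ch Ch0 ChP] := probe_rem_bound r z Dec epsd eps us ds (ltW rho0).
have M0 : 0 < M by exact: lt_le_trans M1.
have Ch1 : 0 < Ch + 1 by rewrite ltr_wpDl.
(* The bound [1] serves [probe_rem_bound]; the other choices keep [C * ((Ch + 1) * amax)] and
   [M * enorm (zeta0 - zs)] each below [rho / 2]. *)
exists (Num.min 1 (rho / (2 * C * (Ch + 1)))), (C * (Ch + 1)), M, lam, (rho / (2 * M)).
split; first by split; rewrite ?lt_min ?ltr01 ?divr_gt0 ?mulr_gt0.
move=> a aP; have a0 i : 0 < a i by have /andP[] := aP i.
pose amax := \big[Num.max/0]_i a i.
have N_gt0 : (0 < N)%N by exact: leq_trans N_ge2.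
have le_amax i : a i <= amax by exact: le_bigmax.
have amax0 : 0 < amax by exact: lt_le_trans (a0 (Ordinal N_gt0)) (le_amax _).
have amaxlt : amax < Num.min 1 (rho / (2 * C * (Ch + 1))).
  apply: bigmax_lt => [|i _]; last by have /andP[] := aP i.
  by rewrite lt_min ltr01 divr_gt0 ?mulr_gt0.
have amax1 : amax <= 1 by apply: ltW; move: amaxlt; rewrite lt_min => /andP[].
have amaxrho : C * ((Ch + 1) * amax) < rho / 2.
  move: amaxlt; rewrite lt_min => /andP[_]; rewrite ltr_pdivlMr ?mulr_gt0//.
  by lra.
have /choice[K KP] := fun i => dyn_averages r Sd m Dec_self gain epsd omb_gt0 omb_inj
  Jref eps a0 zs i (ltW rho0).
pose K' := \sum_i `|K i|.
have K'0 : 0 <= K' by rewrite sumr_ge0.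
(* Beyond this frequency the averaging errors are at most [amax], so the final bound involves [amax]
   alone and [om^-1] is added for free. *)
exists (K' / amax + 1); first by rewrite ltr_wpDl// divr_ge0// ltW.
move=> om omP.
have om0 : 0 < om by apply: lt_trans omP; rewrite ltr_wpDl// divr_ge0// ltW.
have Kom : K' / om <= amax.
  rewrite ler_pdivrMr// mulrC -ler_pdivrMr//.
  by apply: ltW; apply: lt_trans omP; rewrite ltrDl.
move=> zeta0 zeta0P.
pose f := dyn r Sd m z Dec gain epsd Jref omb eps a om.
(* The equation is required only in the ball, so [key] serves twice: for the clipped field, whose
   clipping it shows to be inactive, and for an arbitrary solution. *)
have key (zeta : R -> 'cV[R]_(N + n)) : (forall i, continuous (fun t => zeta t i 0)) ->
    zeta 0 = zeta0 ->
    (forall t : R, 0 < t -> enorm (zeta t - zs) <= rho ->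
      forall i, is_derive t 1 (fun t => zeta t i 0) (f t (zeta t) i 0)) ->
    forall t, 0 <= t -> enorm (zeta t - zs) < rho /\
      enorm (zeta t - zs) <= M * expR (- lam * t) * enorm (zeta0 - zs) +
        C * ((Ch + 1) * amax).
  move=> cz z00 dz; rewrite -z00.
  apply: (stab (fun t => zeta t - zs)).
  - move=> i; have -> : (fun t => (zeta t - zs) i 0) = (fun t => zeta t i 0 - zs i 0).
      by apply/funext => t; rewrite !mxE.
    by apply: cont_sub; [exact: cz|exact: cont_cst].
  - by rewrite mulr_ge0// ltW.
  - rewrite z00; move: zeta0P; rewrite ltr_pdivlMr ?mulr_gt0//; lra.
  move=> T T0 ball; pose th : Th R N n := (PosNum om0, zeta).
  have /choice[w /choice[ev wev]] := fun i => KP i th.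
  have dom t : 0 < t <= T -> Dom r Sd m z Dec gain epsd omb Jref eps a zs rho th t.
    move=> tT; split; first exact: ball.
    by move: (tT) => /andP[t0 _]; apply: dz => //; exact: ball.
  have sumK (v : 'I_(N + n) -> R) : (forall i, `|v i| <= K i / om) ->
      enorm (\col_i v i) <= amax.
    move=> vK; apply: (le_trans (enorm_le_sum _)); apply: le_trans Kom.
    rewrite mulr_suml; apply: ler_sum => i _; rewrite mxE (le_trans (vK i))//.
    by rewrite ler_wpM2r ?invr_ge0 ?ler_norm// ltW.
  exists (fun t => \col_i w i t), (fun t => quad_rem r z Dec gain epsd eps (zeta t - zs) +
     (probe_rem r z Dec epsd eps a (zeta t) - \col_i ev i t)) => t tT.
  have wevt i := wev i t (dom t tT).
  have wb : enorm (\col_i w i t) <= amax by apply: sumK => i; case: (wevt i).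
  have eb : enorm (\col_i ev i t) <= amax by apply: sumK => i; case: (wevt i).
  split.
  - by rewrite (le_trans wb)// ler_peMl ?lerDr// ltW.
  - apply: (le_trans (enormD _ _)); apply: lerD => //.
    apply: (le_trans (enormD _ _)); rewrite enormN mulrDl mul1r lerD//.
    apply: ChP => //; first by move=> i; rewrite a0 le_amax.
      by rewrite amax1 ltW.
    exact: ball.
  - move=> i; have [_ _ dw] := wevt i; have [_ /(_ i) dzi] := dom t tT.
    set g := (X in is_derive _ _ X _).
    have -> : g = (fun t => zeta t i 0 - w i t - zs i 0).
      by apply/funext => u; rewrite /g !mxE addrAC.
    apply: (is_derive_eq (is_deriveB (is_deriveB dzi dw) (is_derive_cst (zs i 0) t (1 : R)))).
    have -> : Ae *m (zeta t - zs) + (quad_rem r z Dec gain epsd eps (zeta t - zs) +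
        (probe_rem r z Dec epsd eps a (zeta t) - \col_i0 ev i0 t)) =
      mean r Sd m z Dec gain epsd Jref eps a (zeta t) - \col_i0 ev i0 t.
      by rewrite (mean_expand Dec_self gain epsd eps equil JE) -/zs !addrA.
    rewrite [RHS]mxE [X in _ = _ + X]mxE [X in _ = _ - X]mxE.
    by rewrite subr0; set y := dyn _ _ _ _ _ _ _ _ _ _ _ _ _ _ _ _; ring.
split.
  have [zeta [z00 cz dz]] := clipped_solution N_gt0 r Sd m z Dec gain epsd omb Jref eps a
    zs zeta0 om (ltW rho0).
  have inball : forall t, 0 <= t -> enorm (zeta t - zs) < rho.
    move=> t t0; apply: (proj1 (key zeta cz z00 _ t t0)) => u u0 ball i.
    by have := dz u u0 i; rewrite (clip_id ball).
  exists zeta => //; split; first exact/continuous_subspaceT/continuous_cV.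
  move=> t t0; apply/is_derive_cV => i; have := dz t t0 i.
  by rewrite clip_id// ltW// inball// ltW.
move=> zeta [cz dz] z00 t t0.
(* [zeta] is arbitrary before time [0]; freezing it there supplies the continuity that [key] asks
   for. *)
pose zeta' (t : R) := zeta (Num.max t 0).
have max0 (u : R) : 0 <= u -> zeta' u = zeta u by move=> u0; rewrite /zeta' max_l.
rewrite -(max0 t t0).
have z'0 : zeta' 0 = zeta0 by rewrite max0.
have dz' (u : R) : 0 < u -> enorm (zeta' u - zs) <= rho ->
    forall i, is_derive u 1 (fun u => zeta' u i 0) (f u (zeta' u) i 0).
  move=> u0 _ i; rewrite (max0 u (ltW u0)).
  have /is_derive_cV/(_ i) dzi := dz u u0.
  apply: near_eq_is_derive dzi; near=> v; rewrite max0//.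
  by near: v; exact: lt_le_nbhsr.
have [_ bound] := key zeta' (continuous_max0 cz) z'0 dz' t t0.
apply: (le_trans bound); rewrite lerD2l mulrA ler_pM2l ?mulr_gt0//.
by rewrite -/amax lerDr invr_ge0 ltW.
Unshelve. all: by end_near. Qed.
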